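(* Suppose that Assumptions (A1)–(A7) hold. Then there exists $\epsilon_0>0$ such that for every $\epsilon$ with $0<\epsilon<\epsilon_0$, Problem 1 (with this $\epsilon$) admits a solution $(u,m)$ with $u,m\in C^{2,\frac12}(\mathbb{T})$ and $m>0$ on $\mathbb{T}$.
   Context: Let $\mathbb{T}=\mathbb{R}/\mathbb{Z}$ be the one-dimensional torus; functions on $\mathbb{T}$ are identified with $1$-periodic functions on $\mathbb{R}$, and integrals over $\mathbb{T}$ are written $\int_0^1$. $C^{k,\frac12}(\mathbb{T})$ denotes the functions of class $C^k$ on $\mathbb{T}$ whose $k$-th derivative is $\frac12$-Hölder continuous. Let $H:\mathbb{R}\to\mathbb{R}$ be of class $C^2$, $V:\mathbb{T}\to\mathbb{R}$ continuous, $\alpha>0$, and $0<\epsilon\le 1$. We say $(u,m)$ solves Problem 1 if $u,m\in C^2(\mathbb{T})$, $m>0$ on $\mathbb{T}$, and on $\mathbb{T}$: $$u-u_{xx}+H(u_x)+V(x)=m^\alpha+\epsilon(m-m_{xx}),\qquad m-m_{xx}-(H'(u_x)m)_x=1-\epsilon(u-u_{xx}).$$ Assumptions: (A1) there exist constants $C_1,C_2,C_3>0$ and $\gamma>1$ such that $-C_1+C_2|p|^\gamma\le H(p)\le C_1+C_3|p|^\gamma$ for all $p\in\mathbb{R}$. (A2) There exist constants $\tilde C_1,\tilde C_2,\tilde C_3>0$ such that $-\tilde C_1+\tilde C_2|p|^\gamma\le pH'(p)-H(p)\le \tilde C_1+\tilde C_3|p|^\gamma$ for all $p$ (same $\gamma$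 as in (A1)). (A3) $V$ is of class $C^2$. (A4) $H$ is convex. (A5) $H$ is of class $C^4$. (A6) $\gamma<2$. (A7) There exists $\bar C>0$ with $|H'(p)|\le \bar C(1+|p|^{\gamma-1})$ for all $p$. *)

(* Defs.v *)
From Stdlib Require Import Reals Lra.
Open Scope R_scope.

(* Functions on the torus T = R/Z are 1-periodic functions on R. *)
Definition periodic1 (f : R -> R) : Prop := forall x, f (x + 1) = f x.

(* |p|^g with the convention 0^g = 0 (g > 0). *)
Definition powabs (p g : R) : R :=
  if Req_EM_T p 0 then 0 else Rpower (Rabs p) g.

Definition C2T (f f1 f2 : R -> R) : Prop :=
  periodic1 f /\
  (forall x, derivable_pt_lim f x (f1 x)) /\
  (forall x, derivable_pt_lim f1 x (f2 x)) /\
  (forall x, continuity_pt f2 x).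

Definition holder_half (g : R -> R) : Prop :=
  exists K, 0 <= K /\ forall x y, Rabs (g x - g y) <= K * sqrt (Rabs (x - y)).

Definition C2halfT (f f1 f2 : R -> R) : Prop :=
  C2T f f1 f2 /\ holder_half f2.

Definition C4R (H H1 H2 H3 H4 : R -> R) : Prop :=
  (forall p, derivable_pt_lim H p (H1 p)) /\
  (forall p, derivable_pt_lim H1 p (H2 p)) /\
  (forall p, derivable_pt_lim H2 p (H3 p)) /\
  (forall p, derivable_pt_lim H3 p (H4 p)) /\
  (forall p, continuity_pt H4 p).

Definition convex (H : R -> R) : Prop :=
  forall x y t, 0 <= t <= 1 ->
    H (t * x + (1 - t) * y) <= t * H x + (1 - t) * H y.

(* (u,m) solves Problem 1 with parameters H (H' = H1), V, alpha, eps,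
   where u1,u2 / m1,m2 are the first and second derivatives of u / m. *)
Definition Problem1 (H H1 V : R -> R) (alpha eps : R)
    (u u1 u2 m m1 m2 : R -> R) : Prop :=
  C2T u u1 u2 /\ C2T m m1 m2 /\ (forall x, 0 < m x) /\
  (forall x, u x - u2 x + H (u1 x) + V x
             = Rpower (m x) alpha + eps * (m x - m2 x)) /\
  exists w : R -> R,
    (forall x, derivable_pt_lim (fun y => H1 (u1 y) * m y) x (w x)) /\
    (forall x, m x - m2 x - w x = 1 - eps * (u x - u2 x)).

(* Main.v *)
From Stdlib Require Import Reals Lra Lia ZArith.
From Coquelicot Require Import Coquelicot.
Require Import Defs.
Open Scope R_scope.

(** The pair of equations is a monotone operator in [(m, u)], because [m H(p)] is convex in [p]
    and linear in [m], and the [eps]-terms make it strongly monotone in [H^1 x H^1].  Replacing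
    [H] and [V] by [lam H] and [lam V + (1 - lam)(1 + eps)] connects the problem, at [lam = 1],
    to one solved by [(u, m) = (0, 1)], at [lam = 0].  Near a solution with [m] bounded below and
    [u_x] bounded, the relaxation [z - tau (1 - d^2/dx^2)^{-1} A z] is a contraction, so a
    solution can be continued over a step in [lam] whose length depends only on those bounds.

    The bounds are uniform.  Testing the equations with [m], [u] and [1] bounds the [L^1] norms
    of [m^alpha], [lam H(u_x)] and [lam H'(u_x) m]; the Green function of [1 - d^2/dx^2] turns
    this into sup bounds on [u], [m], [u_x - eps m_x] and [m_x + eps u_x + lam H'(u_x) m].
    Eliminating [m_x] leaves [(1 + eps^2) u_x + eps lam m H'(u_x)] bounded, and as [H'] is
    nondecreasing this bounds [u_x] and then, after differentiation, [u_xx].  For small [eps] the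
    right-hand side [1 - eps (u - u_xx)] is thus at least [1/2], and the equation for [m] at a
    minimum of [m] gives a positive lower bound.  *)

(** * Continuity and differentiability of real functions *)

(** Energy alone does not close the iteration: the monotonicity is strong in H^1, while Lipschitz
    constants for H(u_x) and H'(u_x) require a sup bound on u_x, which an H^1 bound on u does not
    give. For this reason p = u_x and r = m_x are carried as components of their own, and a weighted
    sup norm of them is contracted together with the energy. This is possible because the local part
    of the p-update that the energy cannot control is monotone in p, hence damping at each point;
    all other source terms are nonlocal, or proportional to the change of m, and are bounded by the
    energy. In the relaxation each unknown is moved by the residual of the other's dual equation, so
    that the linear coupling of u and m is skew and drops out of the squares. The sup bounds on u,
    m, u_x, m_x and u_xx are uniform for 0 < eps <= 1. This order matters: the threshold on eps that
    yields the lower bound on m is chosen after them, without circularity. *)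

Lemma continuity_pt_continuous (f : R -> R) (x : R) :
  continuity_pt f x <-> continuous f x.
Proof. exact (continuity_pt_filterlim f x). Qed.

Lemma cont_const (c : R) : continuity (fun _ => c).
Proof. intros x; apply continuity_pt_const; intros a b; reflexivity. Qed.

Lemma cont_id : continuity (fun x => x).
Proof. intros x; apply continuity_pt_id. Qed.

Lemma cont_plus (f g : R -> R) :
  continuity f -> continuity g -> continuity (fun x => f x + g x).
Proof. exact (continuity_plus f g). Qed.

Lemma cont_minus (f g : R -> R) :
  continuity f -> continuity g -> continuity (fun x => f x - g x).
Proof. exact (continuity_minus f g). Qed.

Lemma cont_opp (f : R -> R) : continuity f -> continuity (fun x => - f x).
Proof. exact (continuity_opp f). Qed.

Lemma cont_mult (f g : R -> R) :
  continuity f -> continuity g -> continuity (fun x => f x * g x).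
Proof. exact (continuity_mult f g). Qed.

Lemma cont_inv (f : R -> R) :
  continuity f -> (forall x, f x <> 0) -> continuity (fun x => / f x).
Proof. intros Hf H0; exact (continuity_inv f Hf H0). Qed.

Lemma cont_comp (f g : R -> R) :
  continuity f -> continuity g -> continuity (fun x => f (g x)).
Proof. intros Hf Hg; exact (continuity_comp g f Hg Hf). Qed.

Lemma cont_abs (f : R -> R) : continuity f -> continuity (fun x => Rabs (f x)).
Proof. intros Hf; apply (cont_comp Rabs f Rcontinuity_abs Hf). Qed.

Lemma cont_pow (f : R -> R) (n : nat) :
  continuity f -> continuity (fun x => f x ^ n).
Proof.
  intros Hf; induction n as [|n IH]; simpl;
    [apply cont_const | apply cont_mult; assumption].
Qed.

Lemma der_cont (f f' : R -> R) :
  (forall x, is_derive f x (f' x)) -> continuity f.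
Proof.
  intros Hd x; apply continuity_pt_continuous, (ex_derive_continuous f).
  exists (f' x); apply Hd.
Qed.

Lemma cont_exp (f : R -> R) : continuity f -> continuity (fun x => exp (f x)).
Proof.
  apply cont_comp; apply (der_cont exp exp).
  intros x; apply is_derive_Reals, derivable_pt_lim_exp.
Qed.

Lemma cont_Rpower (f : R -> R) (a : R) :
  continuity f -> (forall x, 0 < f x) -> continuity (fun x => Rpower (f x) a).
Proof.
  intros Hf Hp x.
  apply (continuity_pt_comp f (fun y => Rpower y a)); [apply Hf|].
  apply continuity_pt_continuous, (ex_derive_continuous (fun y => Rpower y a)).
  exists (a * Rpower (f x) (a - 1)).
  apply is_derive_Reals, derivable_pt_lim_power, Hp.
Qed.

Ltac cont_step :=
  match goal with
  | h : continuity ?f |- continuity ?f => exact h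
  | h : continuity ?f |- continuity (fun x => ?f x) => exact h
  | |- continuity (fun _ => ?c) => apply (cont_const c)
  | |- continuity (fun x => x) => apply cont_id
  | |- continuity (fun x => @?f x + @?g x) => apply (cont_plus f g)
  | |- continuity (fun x => @?f x - @?g x) => apply (cont_minus f g)
  | |- continuity (fun x => - @?f x) => apply (cont_opp f)
  | |- continuity (fun x => @?f x * @?g x) => apply (cont_mult f g)
  | |- continuity (fun x => @?f x / @?g x) =>
      apply (cont_mult f (fun x => / g x))
  | |- continuity (fun x => (@?f x) ^ ?n) => apply (cont_pow f n)
  | |- continuity (fun x => Rabs (@?f x)) => apply (cont_abs f)
  | |- continuity (fun x => exp (@?f x)) => apply (cont_exp f)
  | h : continuity ?k |- continuity (fun x => ?k (@?f x)) => apply (cont_comp k f)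
  end.
Ltac cont := repeat cont_step.
Ltac cont_at :=
  match goal with |- continuity_pt ?f ?x => refine ((_ : continuity f) x); cont end.

Lemma der_eq (f : R -> R) (x l l' : R) : is_derive f x l -> l = l' -> is_derive f x l'.
Proof. intros Hd <-; exact Hd. Qed.

Lemma der_ext (f g : R -> R) (x l : R) :
  (forall y, f y = g y) -> is_derive f x l -> is_derive g x l.
Proof. exact (is_derive_ext f g x l). Qed.

Lemma der_const (c x : R) : is_derive (fun _ => c) x 0.
Proof. apply is_derive_Reals, derivable_pt_lim_const. Qed.

Lemma der_id (x : R) : is_derive (fun y => y) x 1.
Proof. apply is_derive_Reals, derivable_pt_lim_id. Qed.

Lemma der_plus (f g : R -> R) (x a b : R) :
  is_derive f x a -> is_derive g x b -> is_derive (fun y => f y + g y) x (a + b).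
Proof.
  intros Hf Hg; apply is_derive_Reals; apply is_derive_Reals in Hf, Hg.
  exact (derivable_pt_lim_plus f g x a b Hf Hg).
Qed.

Lemma der_minus (f g : R -> R) (x a b : R) :
  is_derive f x a -> is_derive g x b -> is_derive (fun y => f y - g y) x (a - b).
Proof.
  intros Hf Hg; apply is_derive_Reals; apply is_derive_Reals in Hf, Hg.
  exact (derivable_pt_lim_minus f g x a b Hf Hg).
Qed.

Lemma der_opp (f : R -> R) (x a : R) :
  is_derive f x a -> is_derive (fun y => - f y) x (- a).
Proof.
  intros Hf; apply is_derive_Reals; apply is_derive_Reals in Hf.
  exact (derivable_pt_lim_opp f x a Hf).
Qed.

Lemma der_mult (f g : R -> R) (x a b : R) :
  is_derive f x a -> is_derive g x b ->
  is_derive (fun y => f y * g y) x (a * g x + f x * b).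
Proof.
  intros Hf Hg; apply is_derive_Reals; apply is_derive_Reals in Hf, Hg.
  exact (derivable_pt_lim_mult f g x a b Hf Hg).
Qed.

Lemma der_comp (f g : R -> R) (x a b : R) :
  is_derive f (g x) a -> is_derive g x b -> is_derive (fun y => f (g y)) x (a * b).
Proof.
  intros Hf Hg; apply is_derive_Reals; apply is_derive_Reals in Hf, Hg.
  exact (derivable_pt_lim_comp g f x b a Hg Hf).
Qed.

Lemma der_exp (f : R -> R) (x a : R) :
  is_derive f x a -> is_derive (fun y => exp (f y)) x (exp (f x) * a).
Proof. apply (der_comp exp f); apply is_derive_Reals, derivable_pt_lim_exp. Qed.

Lemma der_Rpower (f : R -> R) (x a al : R) : 0 < f x ->
  is_derive f x a ->
  is_derive (fun y => Rpower (f y) al) x (al * Rpower (f x) (al - 1) * a).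
Proof.
  intros Hp; apply (der_comp (fun y => Rpower y al) f).
  apply is_derive_Reals, derivable_pt_lim_power, Hp.
Qed.

Ltac der_step :=
  match goal with
  | h : forall x, is_derive ?f x _ |- is_derive ?f _ _ => apply h
  | h : forall x, is_derive ?f x _ |- is_derive (fun y => ?f y) _ _ => apply h
  | |- is_derive (fun _ => ?c) _ _ => apply (der_const c)
  | |- is_derive (fun y => y) _ _ => apply der_id
  | |- is_derive (fun y => @?f y + @?g y) _ _ => apply (der_plus f g)
  | |- is_derive (fun y => @?f y - @?g y) _ _ => apply (der_minus f g)
  | |- is_derive (fun y => - @?f y) _ _ => apply (der_opp f)
  | |- is_derive (fun y => @?f y * @?g y) _ _ => apply (der_mult f g)
  | |- is_derive (fun y => exp (@?f y)) _ _ => apply (der_exp f)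
  | h : forall x, is_derive ?k x _ |- is_derive (fun y => ?k (@?f y)) _ _ =>
      apply (der_comp k f)
  end.
(** [der_eq] separates the derivative built by the rules, an existential variable, from the one
    claimed; an algebraic identity remains. *)
Ltac der := eapply der_eq; [repeat der_step | cbv beta].

Lemma bounded_on (f : R -> R) (a b : R) :
  (forall x, a <= x <= b -> continuity_pt f x) ->
  exists K, 0 <= K /\ forall x, a <= x <= b -> Rabs (f x) <= K.
Proof.
  intros Hf; destruct (Rle_lt_dec a b) as [Hab|Hab].
  - destruct (continuity_ab_maj (fun x => Rabs (f x)) a b Hab) as [Mx [HM _]].
    + intros c Hc; apply (continuity_pt_comp f Rabs);
        [apply Hf, Hc | apply Rcontinuity_abs].
    + exists (Rabs (f Mx)); split; [apply Rabs_pos | exact HM].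
  - exists 0; split; [lra | intros x Hx; lra].
Qed.

Lemma lipschitz_on (f f' : R -> R) (a b : R) :
  (forall x, a <= x <= b -> is_derive f x (f' x)) ->
  (forall x, a <= x <= b -> continuity_pt f' x) ->
  exists L, 0 <= L /\ forall x y, a <= x <= b -> a <= y <= b ->
    Rabs (f x - f y) <= L * Rabs (x - y).
Proof.
  intros Hd Hc; destruct (bounded_on f' a b Hc) as [L [HL0 HL]].
  exists L; split; [exact HL0 | intros x y Hx Hy].
  assert (Hin : forall c, Rmin y x <= c <= Rmax y x -> a <= c <= b).
  { intros c; unfold Rmin, Rmax; destruct (Rle_dec y x); lra. }
  destruct (MVT_gen f y x f') as [c [Hc1 Hc2]].
  - intros c Hcc; apply Hd, Hin; lra.
  - intros c Hcc; apply continuity_pt_continuous, (ex_derive_continuous f).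
    exists (f' c); apply Hd, Hin, Hcc.
  - rewrite Hc2, Rabs_mult; apply Rmult_le_compat_r; [apply Rabs_pos|].
    apply HL, Hin, Hc1.
Qed.

(** * Periodic functions *)

Lemma periodic1_nat (f : R -> R) (n : nat) (x : R) :
  periodic1 f -> f (x + INR n) = f x.
Proof.
  intros Hf; induction n as [|n IH]; [simpl; f_equal; lra|].
  rewrite S_INR, <- Rplus_assoc, Hf; exact IH.
Qed.

Lemma periodic1_Z (f : R -> R) (k : Z) (x : R) :
  periodic1 f -> f (x + IZR k) = f x.
Proof.
  intros Hf; destruct (Z_le_gt_dec 0 k) as [Hk|Hk].
  - rewrite <- (Z2Nat.id k Hk), <- INR_IZR_INZ; apply periodic1_nat, Hf.
  - rewrite <- (periodic1_nat f (Z.to_nat (- k)) (x + IZR k) Hf).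
    rewrite INR_IZR_INZ, Z2Nat.id by lia; rewrite opp_IZR; f_equal; ring.
Qed.

Lemma periodic1_reduce (x : R) :
  exists y, 0 <= y <= 1 /\ forall f, periodic1 f -> f x = f y.
Proof.
  destruct (archimed x) as [Ha Hb].
  exists (x - IZR (up x) + 1); split; [lra|]; intros f Hf.
  rewrite <- (periodic1_Z f (1 - up x) x Hf), minus_IZR; f_equal; ring.
Qed.

Lemma periodic1_bounded (f : R -> R) : periodic1 f -> continuity f ->
  exists K, 0 <= K /\ forall x, Rabs (f x) <= K.
Proof.
  intros Hp Hc; destruct (bounded_on f 0 1) as [K [HK0 HK]].
  { intros x _; apply Hc. }
  exists K; split; [exact HK0 | intros x].
  destruct (periodic1_reduce x) as [y [Hy He]]; rewrite (He f Hp); apply HK, Hy.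
Qed.

Lemma periodic1_min (f : R -> R) : periodic1 f -> continuity f ->
  exists x0, forall x, f x0 <= f x.
Proof.
  intros Hp Hc; destruct (continuity_ab_min f 0 1) as [x0 [H0 _]];
    [lra | intros c _; apply Hc |].
  exists x0; intros x; destruct (periodic1_reduce x) as [y [Hy He]].
  rewrite (He f Hp); apply H0, Hy.
Qed.

Lemma der_shift (f : R -> R) (x c l : R) :
  is_derive f (x + c) l -> is_derive (fun y => f (y + c)) x l.
Proof.
  intros Hf; eapply der_eq.
  - apply (der_comp f (fun y => y + c)); [exact Hf|].
    apply der_plus; [apply der_id | apply der_const].
  - ring.
Qed.

Lemma periodic1_der (f f' : R -> R) :
  periodic1 f -> (forall x, is_derive f x (f' x)) -> periodic1 f'.
Proof.
  intros Hp Hd x.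
  rewrite <- (is_derive_unique f x (f' x) (Hd x)).
  symmetry; apply is_derive_unique.
  apply (der_ext (fun y => f (y + 1))); [exact Hp|].
  apply der_shift, Hd.
Qed.

Lemma der_min (f : R -> R) (x0 l : R) :
  (forall x, f x0 <= f x) -> is_derive f x0 l -> l = 0.
Proof.
  intros Hm Hd; apply is_derive_Reals in Hd.
  assert (pr : derivable_pt f x0) by (exists l; exact Hd).
  rewrite <- (derive_pt_eq_0 f x0 l pr Hd).
  apply (deriv_minimum f (x0 - 1) (x0 + 1) x0 pr); try lra.
  intros y _ _; apply Hm.
Qed.

(** Only some points arbitrarily close on the right are required, because the mean value theorem in
    [der2_min] supplies no more than that. *)
Lemma der_nonneg_right (f : R -> R) (x0 l : R) :
  (forall eta, 0 < eta -> exists y, x0 < y < x0 + eta /\ f x0 <= f y) ->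
  is_derive f x0 l -> 0 <= l.
Proof.
  intros Hm Hd; apply is_derive_Reals in Hd.
  destruct (Rle_lt_dec 0 l) as [|Hl]; [assumption|exfalso].
  destruct (Hd (- l) ltac:(lra)) as [d Hdd].
  destruct (Hm d (cond_pos d)) as [y [Hy Hfy]].
  specialize (Hdd (y - x0)).
  replace (x0 + (y - x0)) with y in Hdd by ring.
  rewrite (Rabs_pos_eq (y - x0)) in Hdd by lra.
  specialize (Hdd ltac:(lra) ltac:(lra)).
  apply Rabs_def2 in Hdd.
  assert (0 <= (f y - f x0) / (y - x0)); [|lra].
  apply Rmult_le_pos; [lra|]; left; apply Rinv_0_lt_compat; lra.
Qed.

Lemma der2_min (f f' : R -> R) (x0 l : R) :
  (forall x, f x0 <= f x) -> (forall x, is_derive f x (f' x)) ->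
  is_derive f' x0 l -> 0 <= l.
Proof.
  intros Hm Hd; apply der_nonneg_right; intros eta He.
  destruct (MVT_cor2 f f' x0 (x0 + eta / 2)) as [c [Hc1 Hc2]]; [lra| |].
  - intros c _; apply is_derive_Reals, Hd.
  - exists c; split; [lra|].
    rewrite (der_min f x0 (f' x0) Hm (Hd x0)).
    specialize (Hm (x0 + eta / 2)); nra.
Qed.

(** * Mean value over a period *)

Definition mean (f : R -> R) : R := RInt f 0 1.

Lemma cont_ex_RInt (f : R -> R) (a b : R) : continuity f -> ex_RInt f a b.
Proof.
  intros Hf; apply (ex_RInt_continuous f); intros z _.
  apply continuity_pt_continuous, Hf.
Qed.

Lemma mean_plus (f g : R -> R) : continuity f -> continuity g ->
  mean (fun x => f x + g x) = mean f + mean g.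
Proof. intros Hf Hg; apply (RInt_plus f g); apply cont_ex_RInt; assumption. Qed.

Lemma mean_scal (c : R) (f : R -> R) : continuity f ->
  mean (fun x => c * f x) = c * mean f.
Proof. intros Hf; apply (RInt_scal f); apply cont_ex_RInt; assumption. Qed.

Lemma mean_const (c : R) : mean (fun _ => c) = c.
Proof. unfold mean; rewrite RInt_const; unfold scal; simpl; unfold mult; simpl; ring. Qed.

Lemma mean_ext (f g : R -> R) : (forall x, f x = g x) -> mean f = mean g.
Proof. intros He; apply RInt_ext; intros x _; apply He. Qed.

Lemma mean_le (f g : R -> R) : continuity f -> continuity g ->
  (forall x, f x <= g x) -> mean f <= mean g.
Proof.
  intros Hf Hg Hl; apply RInt_le; try (apply cont_ex_RInt; assumption); [lra|].
  intros x _; apply Hl.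
Qed.

Lemma mean_derivative (f f' : R -> R) : periodic1 f -> continuity f' ->
  (forall x, is_derive f x (f' x)) -> mean f' = 0.
Proof.
  intros Hp Hc Hd; apply is_RInt_unique.
  replace 0 with (minus (f 1) (f 0)) at 2.
  - apply (is_RInt_derive f f'); intros x _; [apply Hd|].
    apply continuity_pt_continuous, Hc.
  - unfold minus, plus, opp; simpl; rewrite <- (Hp 0), Rplus_0_l; ring.
Qed.

(** Cauchy-Schwarz, read off from (|f| - c)^2 >= 0 with c the mean of |f|. *)
Lemma mean_abs_sq (f : R -> R) : continuity f ->
  (mean (fun x => Rabs (f x)))^2 <= mean (fun x => f x ^ 2).
Proof.
  intros Hf; set (c := mean (fun x => Rabs (f x))).
  assert (Hle : mean (fun x => 2 * c * Rabs (f x) + - c^2) <= mean (fun x => f x ^ 2)).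
  { apply mean_le; [cont | cont |]; intros x.
    rewrite <- (pow2_abs (f x)).
    assert (Hs := pow2_ge_0 (Rabs (f x) - c)); lra. }
  rewrite mean_plus, mean_scal, mean_const in Hle by cont.
  fold c in Hle; lra.
Qed.

Lemma RInt_shift (f : R -> R) (a b c : R) : continuity f ->
  RInt (fun y => f (y + c)) a b = RInt f (a + c) (b + c).
Proof.
  intros Hf.
  replace (a + c) with (1 * a + c) by ring; replace (b + c) with (1 * b + c) by ring.
  rewrite <- (RInt_comp_lin f 1 c a b) by (apply cont_ex_RInt; exact Hf).
  apply RInt_ext; intros x _; unfold scal; simpl; unfold mult; simpl.
  rewrite !Rmult_1_l; reflexivity.
Qed.

Lemma RInt_period (f : R -> R) (x : R) : continuity f -> periodic1 f ->
  RInt f x (x + 1) = mean f.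
Proof.
  intros Hf Hp; unfold mean.
  assert (E1 := RInt_Chasles f 0 x (x + 1) (cont_ex_RInt f _ _ Hf) (cont_ex_RInt f _ _ Hf)).
  assert (E2 := RInt_Chasles f 0 1 (x + 1) (cont_ex_RInt f _ _ Hf) (cont_ex_RInt f _ _ Hf)).
  assert (E3 := RInt_shift f 0 x 1 Hf); rewrite Rplus_0_l in E3.
  rewrite (RInt_ext _ f) in E3 by (intros y _; apply Hp).
  unfold plus in E1, E2; simpl in E1, E2; lra.
Qed.

Lemma periodic1_reflect (f : R -> R) : periodic1 f -> periodic1 (fun y => f (- y)).
Proof.
  intros Hp x; rewrite <- (Hp (- (x + 1))); f_equal; ring.
Qed.

Lemma mean_reflect (f : R -> R) : continuity f -> periodic1 f ->
  mean (fun y => f (- y)) = mean f.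
Proof.
  intros Hf Hp; unfold mean.
  assert (E := RInt_comp_lin f (-1) 0 0 1 (cont_ex_RInt f _ _ Hf)).
  rewrite (RInt_ext _ (fun y => scal (-1) (f (- y)))) in E.
  2:{ intros y _; do 2 f_equal; ring. }
  rewrite (RInt_scal (fun y => f (- y))) in E
    by (apply (cont_ex_RInt (fun y => f (- y))); cont).
  replace (-1 * 0 + 0) with 0 in E by ring.
  replace (-1 * 1 + 0) with (-1) in E by ring.
  assert (E2 := opp_RInt_swap f (-1) 0 (cont_ex_RInt f _ _ Hf)).
  assert (E3 := RInt_period f (-1) Hf Hp).
  replace (-1 + 1) with 0 in E3 by ring.
  unfold mean in E3; unfold opp in E2; unfold scal in E; simpl in E, E2.
  unfold mult in E; simpl in E; lra.
Qed.

(** Integrating (v^2)' = 2 v v' from y to x gives v(x)^2 <= v(y)^2 + S; averaging over y costs a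
    second S. *)
Lemma sobolev (v v' : R -> R) (x : R) : periodic1 v -> continuity v' ->
  (forall x, is_derive v x (v' x)) ->
  v x ^ 2 <= 2 * mean (fun y => v y ^ 2 + v' y ^ 2).
Proof.
  intros Hp Hc Hd; assert (Hv := der_cont v v' Hd).
  assert (Hcc : continuity (fun t => v t ^ 2 + v' t ^ 2)) by cont.
  assert (Hpp : periodic1 (fun t => v t ^ 2 + v' t ^ 2)).
  { intros t; rewrite Hp, (periodic1_der v v' Hp Hd); reflexivity. }
  set (S := mean (fun y => v y ^ 2 + v' y ^ 2)).
  destruct (periodic1_reduce x) as [x' [Hx' Hxe]]; rewrite (Hxe v Hp); clear x Hxe.
  assert (Hpt : forall y, 0 < y < 1 -> v x' ^ 2 <= v y ^ 2 + S).
  { intros y Hy.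
    (* Of the representatives of x' the one in [y, y + 1] is taken, so that the path from y to it
       stays within one period. *)
    set (z := if Rle_dec y x' then x' else x' + 1).
    assert (Hz : y <= z <= y + 1 /\ v z = v x').
    { unfold z; destruct (Rle_dec y x'); [split; [lra|reflexivity]|].
      split; [lra | apply Hp]. }
    destruct Hz as [Hz Hvz]; rewrite <- Hvz.
    assert (E : RInt (fun t => 2 * (v t * v' t)) y z = v z ^ 2 - v y ^ 2).
    { apply is_RInt_unique; apply (is_RInt_derive (fun t => v t ^ 2)); intros t _.
      - apply (der_ext (fun t => v t * v t)); [intros; simpl; ring|].
        der; simpl; ring.
      - apply continuity_pt_continuous; cont_at. }
    assert (L1 : RInt (fun t => 2 * (v t * v' t)) y z
                 <= RInt (fun t => v t ^ 2 + v' t ^ 2) y z).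
    { apply RInt_le; [lra | apply cont_ex_RInt; cont | apply cont_ex_RInt; cont |].
      intros t _; assert (Hs := pow2_ge_0 (v t - v' t)); lra. }
    assert (L2 : 0 <= RInt (fun t => v t ^ 2 + v' t ^ 2) z (y + 1)).
    { apply RInt_ge_0; [lra | apply cont_ex_RInt; cont |].
      intros t _; assert (Hs := pow2_ge_0 (v t)); assert (Hs' := pow2_ge_0 (v' t)); lra. }
    assert (E1 := RInt_Chasles _ y z (y + 1) (cont_ex_RInt _ y z Hcc) (cont_ex_RInt _ z (y + 1) Hcc)).
    rewrite (RInt_period _ y Hcc Hpp) in E1; fold S in E1.
    unfold plus in E1; simpl in E1, E, L1, L2 |- *; lra. }
  assert (Hm : mean (fun _ => v x' ^ 2) <= mean (fun y => v y ^ 2 + S)).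
  { apply RInt_le; [lra | apply cont_ex_RInt; cont | apply cont_ex_RInt; cont | exact Hpt]. }
  rewrite mean_const, mean_plus, mean_const in Hm by cont.
  assert (Hm2 : mean (fun y => v y ^ 2) <= S).
  { apply mean_le; [cont|exact Hcc|]; intros t; assert (Hs := pow2_ge_0 (v' t)); lra. }
  lra.
Qed.

(** * The periodic Green operator of [1 - d^2/dx^2] *)

(* Factor [1 - d^2] as [(1 - d)(1 + d)]: [greenA f] and [greenB f] are the periodic
   solutions of [a - a' = f] and [b + b' = f], so that [v = (a + b) / 2] solves
   [v - v'' = f] and [v' = (a - b) / 2]. *)
Definition greenA (f : R -> R) (x : R) : R :=
  exp x * RInt (fun y => exp (- y) * f y) x (x + 1) / (1 - exp (- 1)).

Definition greenB (f : R -> R) (x : R) : R := greenA (fun y => f (- y)) (- x).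

Definition green (f : R -> R) (x : R) : R := (greenA f x + greenB f x) / 2.
Definition dgreen (f : R -> R) (x : R) : R := (greenA f x - greenB f x) / 2.

Lemma exp_m1_lt : exp (- 1) < / 2.
Proof.
  replace (- 1) with (- (1)) by ring.
  rewrite exp_Ropp; apply Rinv_lt_contravar; [assert (Hp := exp_pos 1); lra|].
  assert (Hi := exp_ineq1 1); lra.
Qed.

(** With [P] a primitive of e^{-y} f(y), the integral is P(x + 1) - P(x). By periodicity of [f] its
    derivative is e^{-x} (e^{-1} - 1) f(x), which the prefactor normalises to -f(x). *)
Lemma greenA_derive (f : R -> R) (x : R) : continuity f -> periodic1 f ->
  is_derive (greenA f) x (greenA f x - f x).
Proof.
  intros Hf Hp; assert (He := exp_m1_lt).
  set (k := fun y => exp (- y) * f y).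
  assert (Hk : continuity k) by (unfold k; cont).
  set (P := fun x => RInt k 0 x).
  assert (HP : forall x, is_derive P x (k x)).
  { intros y; apply (is_derive_RInt k P 0); [|apply continuity_pt_continuous, Hk].
    apply filter_forall; intros b; apply (RInt_correct k), cont_ex_RInt, Hk. }
  assert (HI : forall y, RInt k y (y + 1) = P (y + 1) - P y).
  { intros y; unfold P.
    assert (E := RInt_Chasles k 0 y (y + 1) (cont_ex_RInt k _ _ Hk) (cont_ex_RInt k _ _ Hk)).
    unfold plus in E; simpl in E; lra. }
  apply (der_ext (fun y => exp y * (P (y + 1) - P y) * / (1 - exp (- 1)))).
  { intros y; unfold greenA; fold k; rewrite HI; reflexivity. }
  eapply der_eq.
  - apply (der_mult _ (fun _ => / (1 - exp (- 1)))); [|apply der_const].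
    apply (der_mult exp); [apply (der_exp (fun y => y)), der_id|].
    apply (der_minus (fun y => P (y + 1))); [apply der_shift, HP | apply HP].
  - unfold greenA; fold k; rewrite HI; unfold k; cbv beta; rewrite Hp.
    replace (exp (- (x + 1))) with (exp (- x) * exp (- 1))
      by (rewrite <- exp_plus; f_equal; ring).
    rewrite (exp_Ropp x); field; split; first [apply Rgt_not_eq, exp_pos | lra].
Qed.

Lemma greenA_periodic (f : R -> R) : continuity f -> periodic1 f -> periodic1 (greenA f).
Proof.
  intros Hf Hp x; unfold greenA; f_equal.
  rewrite <- (RInt_shift (fun y => exp (- y) * f y) x (x + 1) 1) by cont.
  rewrite (RInt_ext _ (fun y => scal (exp (- 1)) (exp (- y) * f y))).
  - rewrite (RInt_scal (fun y => exp (- y) * f y)) by (apply cont_ex_RInt; cont).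
    unfold scal; simpl; unfold mult; simpl.
    rewrite <- Rmult_assoc, <- exp_plus; do 2 f_equal; ring.
  - intros y _; unfold scal; simpl; unfold mult; simpl; rewrite Hp.
    rewrite <- Rmult_assoc, <- exp_plus; do 2 f_equal; ring.
Qed.

(** On [x, x + 1] the kernel e^{x - y} is at most 1, and 1 / (1 - e^{-1}) <= 2. Only the L^1 norm of
    [f] enters, which is all that the energy estimate provides. *)
Lemma greenA_bound (f : R -> R) (x : R) : continuity f -> periodic1 f ->
  Rabs (greenA f x) <= 2 * mean (fun y => Rabs (f y)).
Proof.
  intros Hf Hp; assert (He := exp_m1_lt); assert (Hx := exp_pos x).
  assert (HI : Rabs (RInt (fun y => exp (- y) * f y) x (x + 1))
               <= exp (- x) * mean (fun y => Rabs (f y))).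
  { eapply Rle_trans; [apply abs_RInt_le; [lra | apply cont_ex_RInt; cont]|].
    rewrite <- (RInt_period (fun y => Rabs (f y)) x); [|cont|intros y; rewrite Hp; reflexivity].
    change (exp (- x) * RInt (fun y => Rabs (f y)) x (x + 1))
      with (scal (exp (- x)) (RInt (fun y => Rabs (f y)) x (x + 1))).
    rewrite <- (RInt_scal (fun y => Rabs (f y)) x (x + 1) (exp (- x)))
      by (apply cont_ex_RInt; cont).
    apply RInt_le; [lra | apply cont_ex_RInt; cont | |].
    { apply (cont_ex_RInt (fun y => exp (- x) * Rabs (f y))); cont. }
    intros y Hy; unfold scal; simpl; unfold mult; simpl.
    rewrite Rabs_mult, (Rabs_pos_eq (exp _)) by (left; apply exp_pos).
    apply Rmult_le_compat_r; [apply Rabs_pos|].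
    left; apply exp_increasing; lra. }
  assert (HM : 0 <= mean (fun y => Rabs (f y))).
  { rewrite <- (mean_const 0); apply mean_le; [cont|cont|intros; apply Rabs_pos]. }
  unfold greenA, Rdiv; rewrite !Rabs_mult, (Rabs_pos_eq (exp x)) by lra.
  rewrite (Rabs_pos_eq (/ _)) by (left; apply Rinv_0_lt_compat; lra).
  apply Rle_trans with (mean (fun y => Rabs (f y)) * / (1 - exp (- 1))).
  - apply Rmult_le_compat_r; [left; apply Rinv_0_lt_compat; lra|].
    rewrite exp_Ropp in HI.
    apply (Rmult_le_compat_l (exp x)) in HI; [|lra].
    rewrite <- Rmult_assoc, Rinv_r, Rmult_1_l in HI by lra; exact HI.
  - rewrite Rmult_comm; apply Rmult_le_compat_r; [exact HM|].
    replace 2 with (/ / 2) by field; apply Rinv_le_contravar; lra.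
Qed.

Lemma greenA_minus (f g : R -> R) (x : R) : continuity f -> continuity g ->
  greenA (fun y => f y - g y) x = greenA f x - greenA g x.
Proof.
  intros Hf Hg; unfold greenA.
  rewrite (RInt_ext _ (fun y => minus (exp (- y) * f y) (exp (- y) * g y)))
    by (intros y _; unfold minus, plus, opp; simpl; ring).
  rewrite (RInt_minus (fun y => exp (- y) * f y) (fun y => exp (- y) * g y))
    by (apply cont_ex_RInt; cont).
  unfold minus, plus, opp; simpl; unfold Rdiv; ring.
Qed.

Lemma greenA_const (c x : R) : greenA (fun _ => c) x = c.
Proof.
  unfold greenA; assert (He := exp_m1_lt).
  assert (E : RInt (fun y => exp (- y) * c) x (x + 1)
              = (- c * exp (- (x + 1))) - (- c * exp (- x))).
  { apply is_RInt_unique; apply (is_RInt_derive (fun y => - c * exp (- y))); intros y _.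
    - der; ring.
    - apply continuity_pt_continuous; cont_at. }
  rewrite E; replace (exp (- (x + 1))) with (exp (- x) * exp (- 1))
      by (rewrite <- exp_plus; f_equal; ring).
  rewrite (exp_Ropp x); field; split; first [apply Rgt_not_eq, exp_pos | lra].
Qed.

Lemma cont_reflect (f : R -> R) : continuity f -> continuity (fun y => f (- y)).
Proof. intros Hf; cont. Qed.

Lemma greenB_derive (f : R -> R) (x : R) : continuity f -> periodic1 f ->
  is_derive (greenB f) x (f x - greenB f x).
Proof.
  intros Hf Hp; eapply der_eq.
  - apply (der_comp (greenA (fun y => f (- y))) (fun y => - y)).
    + apply greenA_derive; [apply cont_reflect, Hf | apply periodic1_reflect, Hp].
    + apply (der_opp (fun y => y)), der_id.
  - unfold greenB; rewrite Ropp_involutive; ring.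
Qed.

Lemma greenB_periodic (f : R -> R) : continuity f -> periodic1 f -> periodic1 (greenB f).
Proof.
  intros Hf Hp; apply (periodic1_reflect (greenA (fun y => f (- y)))).
  apply greenA_periodic; [apply cont_reflect, Hf | apply periodic1_reflect, Hp].
Qed.

Lemma greenB_bound (f : R -> R) (x : R) : continuity f -> periodic1 f ->
  Rabs (greenB f x) <= 2 * mean (fun y => Rabs (f y)).
Proof.
  intros Hf Hp.
  rewrite <- (mean_reflect (fun y => Rabs (f y))); [|cont|intros y; rewrite Hp; reflexivity].
  apply (greenA_bound (fun y => f (- y)));
    [apply cont_reflect, Hf | apply periodic1_reflect, Hp].
Qed.

Section GreenOperator.

Variable f : R -> R.
Hypothesis Hf : continuity f.
Hypothesis Hp : periodic1 f.

Lemma green_derive (x : R) : is_derive (green f) x (dgreen f x).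
Proof.
  assert (HA := fun y => greenA_derive f y Hf Hp).
  assert (HB := fun y => greenB_derive f y Hf Hp).
  unfold green, dgreen, Rdiv; der; field.
Qed.

Lemma dgreen_derive (x : R) : is_derive (dgreen f) x (green f x - f x).
Proof.
  assert (HA := fun y => greenA_derive f y Hf Hp).
  assert (HB := fun y => greenB_derive f y Hf Hp).
  unfold green, dgreen, Rdiv; der; field.
Qed.

Lemma green_cont : continuity (green f).
Proof. apply (der_cont _ _ green_derive). Qed.

Lemma dgreen_cont : continuity (dgreen f).
Proof. apply (der_cont _ (fun x => green f x - f x) dgreen_derive). Qed.

Lemma green_periodic : periodic1 (green f).
Proof.
  intros x; unfold green; rewrite greenA_periodic, greenB_periodic by assumption; reflexivity.
Qed.

Lemma dgreen_periodic : periodic1 (dgreen f).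
Proof.
  intros x; unfold dgreen; rewrite greenA_periodic, greenB_periodic by assumption; reflexivity.
Qed.

Lemma green_bound (x : R) : Rabs (green f x) <= 2 * mean (fun y => Rabs (f y)).
Proof.
  assert (HA := greenA_bound f x Hf Hp); assert (HB := greenB_bound f x Hf Hp).
  unfold green; apply Rabs_le_between in HA, HB; apply Rabs_le_between; lra.
Qed.

Lemma dgreen_bound (x : R) : Rabs (dgreen f x) <= 2 * mean (fun y => Rabs (f y)).
Proof.
  assert (HA := greenA_bound f x Hf Hp); assert (HB := greenB_bound f x Hf Hp).
  unfold dgreen; apply Rabs_le_between in HA, HB; apply Rabs_le_between; lra.
Qed.

Lemma green_bound_sup (K : R) (x : R) : (forall y, Rabs (f y) <= K) ->
  Rabs (green f x) <= 2 * K /\ Rabs (dgreen f x) <= 2 * K.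
Proof.
  intros HK.
  assert (HM : mean (fun y => Rabs (f y)) <= K).
  { rewrite <- (mean_const K); apply mean_le; [cont|cont|exact HK]. }
  assert (HG := green_bound x); assert (HD := dgreen_bound x); lra.
Qed.

Lemma green_sq (x : R) : green f x ^ 2 <= 4 * mean (fun y => f y ^ 2).
Proof.
  assert (HA := green_bound x); assert (HB := mean_abs_sq f Hf).
  rewrite <- pow2_abs; assert (HC := Rabs_pos (green f x)); nra.
Qed.

Lemma dgreen_sq (x : R) : dgreen f x ^ 2 <= 4 * mean (fun y => f y ^ 2).
Proof.
  assert (HA := dgreen_bound x); assert (HB := mean_abs_sq f Hf).
  rewrite <- pow2_abs; assert (HC := Rabs_pos (dgreen f x)); nra.
Qed.

(** The integrand is the derivative of [dgreen f * v]; in [dgreen_weak] it is that of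
    [green f * v]. *)
Lemma green_weak (v v' : R -> R) : periodic1 v -> continuity v' ->
  (forall x, is_derive v x (v' x)) ->
  mean (fun x => green f x * v x + dgreen f x * v' x - f x * v x) = 0.
Proof.
  intros Hv Hv' Hd; assert (Hvc := der_cont v v' Hd).
  assert (H1 := green_cont); assert (H2 := dgreen_cont).
  apply (mean_derivative (fun x => dgreen f x * v x)).
  - intros x; rewrite dgreen_periodic, Hv; reflexivity.
  - cont.
  - assert (H3 := dgreen_derive); intros x; der; ring.
Qed.

Lemma dgreen_weak (v v' : R -> R) : periodic1 v -> continuity v' ->
  (forall x, is_derive v x (v' x)) ->
  mean (fun x => dgreen f x * v x + green f x * v' x) = 0.
Proof.
  intros Hv Hv' Hd; assert (Hvc := der_cont v v' Hd).
  assert (H1 := green_cont); assert (H2 := dgreen_cont).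
  apply (mean_derivative (fun x => green f x * v x)).
  - intros x; rewrite green_periodic, Hv; reflexivity.
  - cont.
  - assert (H3 := green_derive); intros x; der; ring.
Qed.

End GreenOperator.

Lemma green_minus (f g : R -> R) (x : R) : continuity f -> continuity g ->
  green (fun y => f y - g y) x = green f x - green g x.
Proof.
  intros Hf Hg; unfold green, greenB.
  rewrite greenA_minus, (greenA_minus (fun y => f (- y)) (fun y => g (- y)));
    try assumption; try (apply cont_reflect; assumption); field.
Qed.

Lemma dgreen_minus (f g : R -> R) (x : R) : continuity f -> continuity g ->
  dgreen (fun y => f y - g y) x = dgreen f x - dgreen g x.
Proof.
  intros Hf Hg; unfold dgreen, greenB.
  rewrite greenA_minus, (greenA_minus (fun y => f (- y)) (fun y => g (- y)));
    try assumption; try (apply cont_reflect; assumption); field.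
Qed.

Lemma greenA_ext (f g : R -> R) (x : R) : (forall y, f y = g y) -> greenA f x = greenA g x.
Proof.
  intros He; unfold greenA; do 2 f_equal; apply RInt_ext; intros y _; rewrite He; reflexivity.
Qed.

Lemma green_const (f : R -> R) (c x : R) : (forall y, f y = c) -> green f x = c.
Proof.
  intros He; unfold green, greenB.
  rewrite (greenA_ext f (fun _ => c)), (greenA_ext (fun y => f (- y)) (fun _ => c)), !greenA_const
    by (intros; apply He); field.
Qed.

Lemma dgreen_const (f : R -> R) (c x : R) : (forall y, f y = c) -> dgreen f x = 0.
Proof.
  intros He; unfold dgreen, greenB.
  rewrite (greenA_ext f (fun _ => c)), (greenA_ext (fun y => f (- y)) (fun _ => c)), !greenA_const
    by (intros; apply He); field.
Qed.

(** * One relaxation step is a contraction *)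

Lemma sq3_le (a b c : R) : (a + b + c) ^ 2 <= 3 * (a ^ 2 + b ^ 2 + c ^ 2).
Proof.
  assert (H1 := pow2_ge_0 (a - b)); assert (H2 := pow2_ge_0 (b - c));
    assert (H3 := pow2_ge_0 (a - c)); nra.
Qed.

Lemma sq4_le (a b c d : R) :
  (a + b + c + d) ^ 2 <= 4 * (a ^ 2 + b ^ 2 + c ^ 2 + d ^ 2).
Proof.
  assert (H1 := pow2_ge_0 (a + b - c - d)); assert (H2 := pow2_ge_0 (a - b));
    assert (H3 := pow2_ge_0 (c - d)); nra.
Qed.

Lemma sq_scal_le (t a : R) : 0 <= t <= 1 -> (t * a) ^ 2 <= a ^ 2.
Proof.
  intros Ht; rewrite Rpow_mult_distr; assert (H1 := pow2_ge_0 a).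
  assert (t ^ 2 <= 1) by nra; nra.
Qed.

Lemma sq_abs_le (a b : R) : Rabs a <= b -> a ^ 2 <= b ^ 2.
Proof. intros H1; rewrite <- (pow2_abs a); assert (H2 := Rabs_pos a); nra. Qed.

(** Names in [d] are differences of two states and of their sources ([dF] in the first equation,
    [dPhi] the flux); [uu], [um], [up], [ur] are the differences after one relaxation step, and [en]
    is the energy density. *)
Section Contraction.

Variables (eps tau L : R) (du dm dp dr dF dPhi : R -> R).
Hypothesis Heps : 0 < eps <= 1.
Hypothesis Htau : 0 < tau.
Hypothesis HtauL : tau * (8 + 136 * L ^ 2) <= eps.
Hypothesis Pu : periodic1 du.
Hypothesis Pm : periodic1 dm.
Hypothesis PF : periodic1 dF.
Hypothesis PPhi : periodic1 dPhi.
Hypothesis Cp : continuity dp.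
Hypothesis Cr : continuity dr.
Hypothesis CF : continuity dF.
Hypothesis CPhi : continuity dPhi.
Hypothesis Du : forall x, is_derive du x (dp x).
Hypothesis Dm : forall x, is_derive dm x (dr x).
Hypothesis HF : forall x, Rabs (dF x) <= L * (Rabs (dm x) + Rabs (dp x)).
Hypothesis HPhi : forall x, Rabs (dPhi x) <= L * (Rabs (dm x) + Rabs (dp x)).
Hypothesis Hmono : forall x, 0 <= dF x * dm x + dPhi x * dp x.
Hypothesis Hsplit : forall x, exists k c, dPhi x = k + c * dm x /\
  0 <= k * dp x /\ Rabs k <= L * Rabs (dp x) /\ Rabs c <= L.

Let en (x : R) : R := du x ^ 2 + dm x ^ 2 + dp x ^ 2 + dr x ^ 2.
Let um (x : R) : R := dm x - tau * (green dF x - (du x - eps * dm x)).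
Let ur (x : R) : R := dr x - tau * (dgreen dF x - (dp x - eps * dr x)).
Let uu (x : R) : R := du x - tau * (dm x + eps * du x - dgreen dPhi x).
Let up (x : R) : R := dp x - tau * (dr x + eps * dp x - green dPhi x + dPhi x).

Lemma contraction_cont : continuity du /\ continuity dm /\ continuity en.
Proof.
  assert (H1 := der_cont du dp Du); assert (H2 := der_cont dm dr Dm).
  repeat split; unfold en; cont.
Qed.

Lemma source_sq (f : R -> R) (x : R) :
  (forall x, Rabs (f x) <= L * (Rabs (dm x) + Rabs (dp x))) -> f x ^ 2 <= 2 * L ^ 2 * en x.
Proof.
  intros Hf; apply Rle_trans with ((L * (Rabs (dm x) + Rabs (dp x))) ^ 2).
  - apply sq_abs_le, Hf.
  - rewrite Rpow_mult_distr, (Rmult_comm 2), Rmult_assoc.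
    apply Rmult_le_compat_l; [apply pow2_ge_0|]; unfold en.
    rewrite <- (pow2_abs (dm x)), <- (pow2_abs (dp x)).
    assert (H1 := pow2_ge_0 (Rabs (dm x) - Rabs (dp x))).
    assert (H2 := pow2_ge_0 (du x)); assert (H3 := pow2_ge_0 (dr x)); nra.
Qed.

Lemma green_source_sq (f : R -> R) (x : R) : continuity f -> periodic1 f ->
  (forall x, Rabs (f x) <= L * (Rabs (dm x) + Rabs (dp x))) ->
  green f x ^ 2 <= 8 * L ^ 2 * mean en /\ dgreen f x ^ 2 <= 8 * L ^ 2 * mean en.
Proof.
  intros Hc Hp Hf; destruct contraction_cont as [Cu [Cm Ce]].
  assert (HM : mean (fun y => f y ^ 2) <= 2 * L ^ 2 * mean en).
  { rewrite <- mean_scal by exact Ce.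
    apply mean_le; [cont | cont |]; intros y; apply source_sq, Hf. }
  assert (H1 := green_sq f Hc Hp x); assert (H2 := dgreen_sq f Hc Hp x); lra.
Qed.

(** In the expanded squares the products du dm and dp dr cancel, the Green terms form the mean-zero
    [X1] and [X2], and [Hmono] discards the sources. This leaves a gain 2 tau eps against tau^2
    times the squared residual, and [HtauL] makes the latter at most half of the gain. *)
Lemma contraction_energy :
  mean (fun x => uu x ^ 2 + um x ^ 2 + up x ^ 2 + ur x ^ 2) <= (1 - tau * eps) * mean en.
Proof.
  destruct contraction_cont as [Cu [Cm Ce]].
  assert (G1 := green_cont dF CF PF); assert (G2 := dgreen_cont dF CF PF).
  assert (G3 := green_cont dPhi CPhi PPhi); assert (G4 := dgreen_cont dPhi CPhi PPhi).
  assert (W1 := green_weak dF CF PF dm dr Pm Cr Dm).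
  assert (W2 := dgreen_weak dPhi CPhi PPhi du dp Pu Cp Du).
  set (X1 := fun x => green dF x * dm x + dgreen dF x * dr x - dF x * dm x) in W1.
  set (X2 := fun x => dgreen dPhi x * du x + green dPhi x * dp x) in W2.
  assert (CX1 : continuity X1) by (unfold X1; cont).
  assert (CX2 : continuity X2) by (unfold X2; cont).
  assert (HE : 0 <= mean en).
  { rewrite <- (mean_const 0); apply mean_le; [cont|exact Ce|]; intros x; unfold en.
    assert (T1 := pow2_ge_0 (du x)); assert (T2 := pow2_ge_0 (dm x));
    assert (T3 := pow2_ge_0 (dp x)); assert (T4 := pow2_ge_0 (dr x)); lra. }
  assert (Hle : mean (fun x => uu x ^ 2 + um x ^ 2 + up x ^ 2 + ur x ^ 2)
     <= mean (fun x => (1 - 2 * tau * eps + tau ^ 2 * (8 + 8 * L ^ 2)) * en x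
          + (tau ^ 2 * (128 * L ^ 2 * mean en) + (- (2 * tau) * X1 x + 2 * tau * X2 x)))).
  { apply mean_le.
    - unfold uu, um, up, ur; cont.
    - cont.
    - intros x.
      destruct (green_source_sq dF x CF PF HF) as [B1 B2].
      destruct (green_source_sq dPhi x CPhi PPhi HPhi) as [B3 B4].
      assert (B5 := source_sq dPhi x HPhi).
      assert (HM := Hmono x).
      set (bm := green dF x - (du x - eps * dm x)).
      set (br := dgreen dF x - (dp x - eps * dr x)).
      set (bu := dm x + eps * du x - dgreen dPhi x).
      set (bp := dr x + eps * dp x - green dPhi x + dPhi x).
      (* The coefficients are rounded up from [sq3_le], [sq4_le] and the Green bounds; added
         together they are the 8 + 136 L^2 of [HtauL]. *)
      assert (HQ : bm ^ 2 + br ^ 2 + bu ^ 2 + bp ^ 2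
                   <= 128 * L ^ 2 * mean en + (8 + 8 * L ^ 2) * en x).
      { assert (Q1 := sq3_le (green dF x) (- du x) (eps * dm x)).
        assert (Q2 := sq3_le (dgreen dF x) (- dp x) (eps * dr x)).
        assert (Q3 := sq3_le (dm x) (eps * du x) (- dgreen dPhi x)).
        assert (Q4 := sq4_le (dr x) (eps * dp x) (- green dPhi x) (dPhi x)).
        replace (green dF x + - du x + eps * dm x) with bm in Q1 by (unfold bm; ring).
        replace (dgreen dF x + - dp x + eps * dr x) with br in Q2 by (unfold br; ring).
        replace (dm x + eps * du x + - dgreen dPhi x) with bu in Q3 by (unfold bu; ring).
        replace (dr x + eps * dp x + - green dPhi x + dPhi x) with bp in Q4
          by (unfold bp; ring).
        assert (S1 := sq_scal_le eps (dm x) ltac:(lra)).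
        assert (S2 := sq_scal_le eps (dr x) ltac:(lra)).
        assert (S3 := sq_scal_le eps (du x) ltac:(lra)).
        assert (S4 := sq_scal_le eps (dp x) ltac:(lra)).
        assert (T1 := pow2_ge_0 (du x)); assert (T2 := pow2_ge_0 (dm x));
        assert (T3 := pow2_ge_0 (dp x)); assert (T4 := pow2_ge_0 (dr x)).
        assert (T5 : 0 <= L ^ 2 * mean en) by (apply Rmult_le_pos; [apply pow2_ge_0|lra]).
        assert (N : forall a, (- a) ^ 2 = a ^ 2) by (intros; ring).
        rewrite !N in Q1, Q2, Q3, Q4.
        assert (E1 : (8 + 8 * L ^ 2) * en x
          = 8 * (du x ^ 2 + dm x ^ 2 + dp x ^ 2 + dr x ^ 2) + 4 * (2 * L ^ 2 * en x))
          by (unfold en; ring).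
        rewrite E1; lra. }
      assert (E : uu x ^ 2 + um x ^ 2 + up x ^ 2 + ur x ^ 2
        = (1 - 2 * tau * eps) * en x + tau ^ 2 * (bm ^ 2 + br ^ 2 + bu ^ 2 + bp ^ 2)
          + (- (2 * tau) * X1 x + 2 * tau * X2 x)
          - 2 * tau * (dF x * dm x + dPhi x * dp x)).
      { unfold uu, um, up, ur, en, X1, X2, bm, br, bu, bp; ring. }
      rewrite E.
      apply (Rmult_le_compat_l (tau ^ 2)) in HQ; [|apply pow2_ge_0].
      assert (0 <= 2 * tau * (dF x * dm x + dPhi x * dp x)) by (apply Rmult_le_pos; lra).
      lra. }
  eapply Rle_trans; [exact Hle|].
  rewrite mean_plus, mean_plus, mean_plus, !mean_scal, mean_const, W1, W2 by cont.
  apply (Rmult_le_compat_l tau) in HtauL; [|lra].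
  apply (Rmult_le_compat_r (mean en)) in HtauL; [|exact HE]; lra.
Qed.

Let s : R := tau * eps / 2.

(** The dp dr products cancel and [k] has the sign of [dp], so the local part [a], [b] contracts by
    1 - 2 s at each point. The nonlocal terms and c dm are bounded by the mean energy, through the
    Green kernel and [sobolev]; Young's inequality with weight s admits them at the price of one
    s. *)
Lemma contraction_pointwise (x : R) :
  up x ^ 2 + ur x ^ 2
  <= (1 - s) * (dp x ^ 2 + dr x ^ 2) + (1 + / s) * tau ^ 2 * (28 * L ^ 2) * mean en.
Proof.
  destruct contraction_cont as [Cu [Cm Ce]].
  destruct (green_source_sq dF x CF PF HF) as [_ B2].
  destruct (green_source_sq dPhi x CPhi PPhi HPhi) as [B3 _].
  destruct (Hsplit x) as [k [c [Ek [Hk1 [Hk2 Hc]]]]].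
  assert (HS : dm x ^ 2 <= 2 * mean en).
  { eapply Rle_trans; [apply (sobolev dm dr x Pm Cr Dm)|].
    apply Rmult_le_compat_l; [lra|]; apply mean_le; [cont|exact Ce|].
    intros y; unfold en; assert (T1 := pow2_ge_0 (du y)); assert (T3 := pow2_ge_0 (dp y)); lra. }
  set (a := dp x - tau * (dr x + eps * dp x + k)).
  set (b := dr x - tau * (eps * dr x - dp x)).
  set (g1 := green dPhi x - c * dm x).
  set (g2 := - dgreen dF x).
  assert (Ea : up x = a + tau * g1) by (unfold up, a, g1; rewrite Ek; ring).
  assert (Eb : ur x = b + tau * g2) by (unfold ur, b, g2; ring).
  assert (Hs : 0 < s) by (unfold s; assert (0 < tau * eps) by (apply Rmult_lt_0_compat; lra); lra).
  (* 20 = 2 * 8 + 2 * 2, from the Green bound and from [sobolev]; with the 8 of [g2] this is the 28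
     of the conclusion. *)
  assert (Hg1 : g1 ^ 2 <= 20 * L ^ 2 * mean en).
  { assert (Hc2 : (c * dm x) ^ 2 <= L ^ 2 * (2 * mean en)).
    { rewrite Rpow_mult_distr; apply Rmult_le_compat; try apply pow2_ge_0;
        [apply sq_abs_le, Hc | exact HS]. }
    assert (Q := pow2_ge_0 (green dPhi x + c * dm x)); unfold g1; nra. }
  assert (Hg2 : g2 ^ 2 <= 8 * L ^ 2 * mean en) by (unfold g2; lra).
  set (P := dp x ^ 2 + dr x ^ 2).
  assert (Hab : a ^ 2 + b ^ 2 <= (1 - 2 * s) * P).
  { assert (Q1 := sq3_le (dr x) (eps * dp x) k).
    assert (Q2 := pow2_ge_0 (eps * dr x + dp x)).
    assert (S2 := sq_scal_le eps (dr x) ltac:(lra)).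
    assert (S4 := sq_scal_le eps (dp x) ltac:(lra)).
    assert (Hkk : k ^ 2 <= L ^ 2 * dp x ^ 2).
    { rewrite <- (pow2_abs (dp x)), <- Rpow_mult_distr; apply sq_abs_le, Hk2. }
    assert (T3 := pow2_ge_0 (dp x)); assert (T4 := pow2_ge_0 (dr x)).
    assert (TL := pow2_ge_0 L).
    assert (HQ : (dr x + eps * dp x + k) ^ 2 + (eps * dr x - dp x) ^ 2
                 <= (8 + 136 * L ^ 2) * P).
    { assert (0 <= L ^ 2 * dp x ^ 2) by (apply Rmult_le_pos; assumption).
      assert (0 <= L ^ 2 * dr x ^ 2) by (apply Rmult_le_pos; assumption).
      assert ((eps * dr x - dp x) ^ 2 <= 2 * (eps * dr x) ^ 2 + 2 * dp x ^ 2) by nra.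
      unfold P; lra. }
    assert (E : a ^ 2 + b ^ 2 = (1 - 4 * s) * P - 2 * tau * (k * dp x)
      + tau ^ 2 * ((dr x + eps * dp x + k) ^ 2 + (eps * dr x - dp x) ^ 2))
      by (unfold a, b, P, s; field).
    rewrite E.
    apply (Rmult_le_compat_l (tau ^ 2)) in HQ; [|apply pow2_ge_0].
    assert (0 <= 2 * tau * (k * dp x)) by (apply Rmult_le_pos; lra).
    assert (HP : 0 <= P) by (unfold P; lra).
    assert (HT := HtauL).
    apply (Rmult_le_compat_l tau) in HT; [|lra].
    apply (Rmult_le_compat_r P) in HT; [|exact HP].
    replace (tau * eps) with (2 * s) in HT by (unfold s; field); lra. }
  assert (Young : forall y z, (y + tau * z) ^ 2 <= (1 + s) * y ^ 2 + (1 + / s) * tau ^ 2 * z ^ 2).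
  { intros y z.
    assert (Hi : (1 + s) * y ^ 2 + (1 + / s) * tau ^ 2 * z ^ 2 - (y + tau * z) ^ 2
                 = / s * (s * y - tau * z) ^ 2) by (field; lra).
    assert (0 <= / s * (s * y - tau * z) ^ 2).
    { apply Rmult_le_pos; [left; apply Rinv_0_lt_compat, Hs | apply pow2_ge_0]. }
    lra. }
  rewrite Ea, Eb.
  assert (Y1 := Young a g1); assert (Y2 := Young b g2).
  assert (HK : 0 <= (1 + / s) * tau ^ 2).
  { apply Rmult_le_pos; [|apply pow2_ge_0].
    assert (0 < / s) by (apply Rinv_0_lt_compat, Hs); lra. }
  apply (Rmult_le_compat_l _ _ _ HK) in Hg1, Hg2.
  apply (Rmult_le_compat_l (1 + s)) in Hab; [|lra].
  assert (0 <= P) by (unfold P; assert (T3 := pow2_ge_0 (dp x)); assert (T4 := pow2_ge_0 (dr x)); lra).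
  assert ((1 + s) * ((1 - 2 * s) * P) <= (1 - s) * P).
  { assert (0 <= s ^ 2 * P) by (apply Rmult_le_pos; [apply pow2_ge_0|assumption]); lra. }
  lra.
Qed.

End Contraction.

(** * Implicit differentiation *)

(** Caratheodory's slope function: increments become exact products, so that [implicit_derive] can
    solve for an unknown derivative algebraically. *)
Lemma caratheodory (f : R -> R) (x l : R) : is_derive f x l ->
  exists phi, continuity_pt phi x /\ phi x = l /\ forall y, f y - f x = phi y * (y - x).
Proof.
  intros Hd; apply is_derive_Reals in Hd.
  exists (fun y => if Req_EM_T y x then l else (f y - f x) / (y - x)); split; [|split].
  - intros e He; destruct (Hd e He) as [d Hdd].
    exists d; split; [apply cond_pos|]; intros y' [_ Hy'].
    set (y := y' : R); change (Rabs (y - x) < d) in Hy'; simpl; unfold R_dist; fold y.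
    destruct (Req_EM_T x x) as [_|Hx]; [|contradiction Hx; reflexivity].
    destruct (Req_EM_T y x) as [Hyx|Hyx]; [rewrite Rminus_diag, Rabs_R0; exact He|].
    specialize (Hdd (y - x) ltac:(lra) Hy').
    replace (x + (y - x)) with y in Hdd by ring; exact Hdd.
  - destruct (Req_EM_T x x) as [_|Hx]; [reflexivity | contradiction Hx; reflexivity].
  - intros y; destruct (Req_EM_T y x) as [->|Hyx]; [ring | field; lra].
Qed.

Lemma caratheodory_inv (f phi : R -> R) (x : R) : continuity_pt phi x ->
  (forall y, f y - f x = phi y * (y - x)) -> is_derive f x (phi x).
Proof.
  intros Hc Hphi; apply is_derive_Reals; intros e He.
  destruct (Hc e He) as [d [Hd Hdd]].
  exists (mkposreal d Hd); intros h Hh0 Hh; simpl in Hh.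
  replace ((f (x + h) - f x) / h) with (phi (x + h)) by (rewrite Hphi; field; exact Hh0).
  apply (Hdd (x + h)); split.
  - split; [exact I | lra].
  - simpl; unfold R_dist; replace (x + h - x) with h by ring; exact Hh.
Qed.

Lemma implicit_derive (g g' p m Y : R -> R) (a k x r y1 : R) :
  0 < a -> 0 <= k -> (forall p q, 0 <= (g p - g q) * (p - q)) ->
  (forall p, is_derive g p (g' p)) -> (forall p, 0 <= g' p) ->
  (forall y, 0 <= m y) -> (forall y, a * p y + k * m y * g (p y) = Y y) ->
  continuity_pt p x -> is_derive m x r -> is_derive Y x y1 ->
  is_derive p x ((y1 - k * r * g (p x)) / (a + k * m x * g' (p x))).
Proof.
  intros Ha Hk Hmono Hg Hg' Hm HY Hp Dm DY.
  destruct (caratheodory m x r Dm) as [fm [Cm [Em Fm]]].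
  destruct (caratheodory Y x y1 DY) as [fY [CY [EY FY]]].
  destruct (caratheodory g (p x) _ (Hg (p x))) as [S [CS [ES FS]]].
  assert (HS : forall q, 0 <= S q).
  { intros q; destruct (Req_dec q (p x)) as [->|Hq]; [rewrite ES; apply Hg'|].
    assert (T := Hmono q (p x)); rewrite FS in T.
    assert (Hsq : 0 < (q - p x) ^ 2) by (apply pow2_gt_0; lra).
    apply (Rmult_le_reg_r ((q - p x) ^ 2)); [exact Hsq|]; lra. }
  assert (Hden : forall y, 0 < a + k * m y * S (p y)).
  { intros y; assert (0 <= k * m y * S (p y)) by
      (apply Rmult_le_pos; [apply Rmult_le_pos; [exact Hk | apply Hm] | apply HS]); lra. }
  set (phi := fun y => (fY y - k * fm y * g (p x)) / (a + k * m y * S (p y))).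
  replace ((y1 - k * r * g (p x)) / (a + k * m x * g' (p x))) with (phi x)
    by (unfold phi; rewrite EY, Em, ES; reflexivity).
  apply caratheodory_inv.
  - assert (Cmm : continuity_pt m x).
    { apply continuity_pt_continuous, (ex_derive_continuous m); exists r; exact Dm. }
    assert (CSp : continuity_pt (fun y => S (p y)) x)
      by exact (continuity_pt_comp p S x Hp CS).
    assert (Cc : forall c : R, continuity_pt (fun _ => c) x) by (intros c; apply cont_const).
    apply (continuity_pt_div (fun y => fY y - k * fm y * g (p x))
             (fun y => a + k * m y * S (p y))).
    + apply (continuity_pt_minus fY (fun y => k * fm y * g (p x))); [exact CY|].
      apply (continuity_pt_mult (fun y => k * fm y) (fun _ => g (p x))); [|apply Cc].
      apply (continuity_pt_mult (fun _ => k) fm); [apply Cc | exact Cm].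
    + apply (continuity_pt_plus (fun _ => a) (fun y => k * m y * S (p y))); [apply Cc|].
      apply (continuity_pt_mult (fun y => k * m y) (fun y => S (p y))); [|exact CSp].
      apply (continuity_pt_mult (fun _ => k) m); [apply Cc | exact Cmm].
    + apply Rgt_not_eq, Hden.
  - intros y; unfold phi; specialize (Hden y).
    apply (Rmult_eq_reg_r (a + k * m y * S (p y))); [|lra].
    transitivity ((fY y - k * fm y * g (p x)) * (y - x)); [|field; lra].
    replace ((fY y - k * fm y * g (p x)) * (y - x))
      with (fY y * (y - x) - k * g (p x) * (fm y * (y - x))) by ring.
    rewrite <- FY, <- Fm, <- !HY.
    replace ((p y - p x) * (a + k * m y * S (p y)))
      with (a * (p y - p x) + k * m y * (S (p y) * (p y - p x))) by ring.
    rewrite <- FS; ring.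
Qed.

(** * Geometrically convergent sequences of functions *)

(** Passes from identities that hold up to C b^n along the iteration to exact ones for the limit. *)
Lemma geometric_zero (a C b : R) : 0 <= b < 1 ->
  (forall n, Rabs a <= C * b ^ n) -> a = 0.
Proof.
  intros Hb Ha.
  assert (Hl : is_lim_seq (fun n => C * b ^ n) (Rbar_mult C 0)).
  { apply is_lim_seq_scal_l, is_lim_seq_geom; rewrite Rabs_pos_eq; lra. }
  assert (Hl0 : Rbar_le (Rabs a) (Rbar_mult C 0)).
  { apply (is_lim_seq_le (fun _ => Rabs a) (fun n => C * b ^ n));
      [exact Ha | apply is_lim_seq_const | exact Hl]. }
  simpl in Hl0; rewrite Rmult_0_r in Hl0.
  assert (Hp := Rabs_pos a).
  destruct (Req_dec a 0) as [|Hn]; [assumption|].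
  apply Rabs_pos_lt in Hn; lra.
Qed.

(** The factor 1 - b^k is what lets the induction on [k] close. *)
Lemma geometric_sum_bound (u : nat -> R) (C b : R) : 0 <= b < 1 ->
  (forall n, Rabs (u (S n) - u n) <= C * b ^ n) ->
  forall n k, Rabs (u (n + k)%nat - u n) <= C * b ^ n * (1 - b ^ k) / (1 - b).
Proof.
  intros Hb Hu n k; induction k as [|k IH].
  - rewrite Nat.add_0_r, Rminus_diag, Rabs_R0; simpl; unfold Rdiv.
    rewrite Rminus_diag, Rmult_0_r, Rmult_0_l; lra.
  - rewrite Nat.add_succ_r.
    replace (u (S (n + k)) - u n) with ((u (S (n + k)) - u (n + k)%nat) + (u (n + k)%nat - u n))
      by ring.
    eapply Rle_trans; [apply Rabs_triang|].
    eapply Rle_trans; [apply Rplus_le_compat; [apply Hu | apply IH]|].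
    right; rewrite pow_add; simpl; field; lra.
Qed.

Lemma geometric_limit (f : nat -> R -> R) (C b : R) : 0 <= b < 1 -> 0 <= C ->
  (forall n, continuity (f n)) ->
  (forall n x, Rabs (f (S n) x - f n x) <= C * b ^ n) ->
  exists g, continuity g /\ forall n x, Rabs (f n x - g x) <= C / (1 - b) * b ^ n.
Proof.
  intros Hb HC Hc Hf.
  assert (Hpos : 0 <= C / (1 - b)).
  { apply Rmult_le_pos; [exact HC | left; apply Rinv_0_lt_compat; lra]. }
  assert (Hpow : forall n, 0 <= b ^ n <= 1).
  { intros n; split; [apply pow_le; lra|].
    rewrite <- (pow1 n); apply pow_incr; lra. }
  assert (Hnk : forall x n k, Rabs (f (n + k)%nat x - f n x) <= C / (1 - b) * b ^ n).
  { intros x n k.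
    eapply Rle_trans; [apply (geometric_sum_bound (fun n => f n x) C b Hb)|].
    - intros j; apply Hf.
    - replace (C * b ^ n * (1 - b ^ k) / (1 - b)) with (C / (1 - b) * b ^ n * (1 - b ^ k))
        by (field; lra).
      assert (0 <= C / (1 - b) * b ^ n) by (apply Rmult_le_pos; [exact Hpos | apply Hpow]).
      specialize (Hpow k); nra. }
  assert (Hsmall : forall e, 0 < e -> exists N, C / (1 - b) * b ^ N < e).
  { intros e He.
    assert (Hl : is_lim_seq (fun n => C / (1 - b) * b ^ n) (Rbar_mult (C / (1 - b)) 0)).
    { apply is_lim_seq_scal_l, is_lim_seq_geom; rewrite Rabs_pos_eq; lra. }
    simpl in Hl; rewrite Rmult_0_r in Hl; apply is_lim_seq_spec in Hl.
    destruct (Hl (mkposreal e He)) as [N HN].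
    exists N; specialize (HN N (le_n N)); simpl in HN; rewrite Rminus_0_r in HN.
    rewrite Rabs_pos_eq in HN; [exact HN|].
    apply Rmult_le_pos; [exact Hpos | apply Hpow]. }
  assert (Hlim : forall x, exists l, is_lim_seq (fun n => f n x) (Finite l)).
  { intros x; apply ex_lim_seq_cauchy_corr; intros e.
    destruct (Hsmall (e / 2)) as [N HN]; [assert (He := cond_pos e); lra|].
    exists N; intros i j Hi Hj.
    assert (B1 := Hnk x N (i - N)%nat); assert (B2 := Hnk x N (j - N)%nat).
    replace (N + (i - N))%nat with i in B1 by lia.
    replace (N + (j - N))%nat with j in B2 by lia.
    apply Rabs_le_between in B1, B2; apply Rabs_lt_between; lra. }
  set (g := fun x => real (Lim_seq (fun n => f n x))).
  assert (Hg : forall x, is_lim_seq (fun n => f n x) (Finite (g x))).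
  { intros x; destruct (Hlim x) as [l Hl]; unfold g.
    rewrite (is_lim_seq_unique _ _ Hl); exact Hl. }
  assert (Hfg : forall n x, Rabs (f n x - g x) <= C / (1 - b) * b ^ n).
  { intros n x; rewrite Rabs_minus_sym.
    assert (Hl : Rbar_le (Rabs (g x - f n x)) (C / (1 - b) * b ^ n)).
    { apply (is_lim_seq_le (fun k => Rabs (f (n + k)%nat x - f n x))
               (fun _ => C / (1 - b) * b ^ n)).
      - intros k; apply Hnk.
      - apply (is_lim_seq_abs _ (Finite (g x - f n x))).
        apply is_lim_seq_minus'; [|apply is_lim_seq_const].
        apply (is_lim_seq_ext (fun k => f (k + n)%nat x)).
        + intros k; rewrite Nat.add_comm; reflexivity.
        + apply (is_lim_seq_incr_n (fun k => f k x)), Hg.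
      - apply is_lim_seq_const. }
    exact Hl. }
  exists g; split; [|exact Hfg].
  intros x e He; destruct (Hsmall (e / 3)) as [N HN]; [lra|].
  destruct (Hc N x (e / 3)) as [d [Hd Hdd]]; [lra|].
  exists d; split; [exact Hd|]; intros y Hy.
  specialize (Hdd y Hy); simpl in Hdd |- *; unfold R_dist in Hdd |- *.
  assert (B1 := Hfg N x); assert (B2 := Hfg N y).
  apply Rabs_le_between in B1, B2; apply Rabs_lt_between in Hdd; apply Rabs_lt_between; lra.
Qed.

Lemma limit_periodic (f : nat -> R -> R) (g : R -> R) (C b : R) : 0 <= b < 1 ->
  (forall n, periodic1 (f n)) -> (forall n x, Rabs (f n x - g x) <= C * b ^ n) ->
  periodic1 g.
Proof.
  intros Hb Hp Hfg x; apply Rminus_diag_uniq, (geometric_zero _ (2 * C) b Hb).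
  intros n; assert (B1 := Hfg n x); assert (B2 := Hfg n (x + 1)); rewrite Hp in B2.
  apply Rabs_le_between in B1, B2; apply Rabs_le_between; lra.
Qed.

(** * The homotopy between a trivial problem and Problem 1 *)

(** That [sp] and [sr] are the derivatives of [su] and [sm] is a separate predicate, [curve]. It is
    not passed to the limit of the iteration: [sol_curve] recovers it from the fixed-point
    equations. *)
Record state : Type := State { su : R -> R; sm : R -> R; sp : R -> R; sr : R -> R }.

Record reg (z : state) : Prop := Reg {
  reg_cu : continuity (su z); reg_cm : continuity (sm z);
  reg_cp : continuity (sp z); reg_cr : continuity (sr z);
  reg_pu : periodic1 (su z); reg_pm : periodic1 (sm z);
  reg_pp : periodic1 (sp z); reg_pr : periodic1 (sr z) }.

Record adm (z : state) : Prop := Adm {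
  adm_reg : reg z; adm_pos : forall x, 0 < sm z x }.

Definition curve (z : state) : Prop :=
  (forall x, is_derive (su z) x (sp z x)) /\ (forall x, is_derive (sm z) x (sr z x)).

(** Only [sm] and [sp] are confined, being the only arguments of the nonlinear terms. *)
Definition box (dl M R0 : R) (z : state) : Prop :=
  forall x, dl <= sm z x <= M /\ Rabs (sp z x) <= R0.

Definition dist2 (z1 z2 : state) (x : R) : R :=
  (su z1 x - su z2 x) ^ 2 + (sm z1 x - sm z2 x) ^ 2
  + (sp z1 x - sp z2 x) ^ 2 + (sr z1 x - sr z2 x) ^ 2.

(* An [H^1] ball for [(u, m)] intersected with a weighted sup-norm ball for the derivatives:
   relaxation contracts the former, and the latter up to the former. *)
Definition near (kap a : R) (z1 z2 : state) : Prop :=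
  mean (dist2 z1 z2) <= a /\
  forall x, kap * ((sp z1 x - sp z2 x) ^ 2 + (sr z1 x - sr z2 x) ^ 2) <= a.

Definition close (d : R) (z1 z2 : state) : Prop := forall x,
  Rabs (su z1 x - su z2 x) <= d /\ Rabs (sm z1 x - sm z2 x) <= d /\
  Rabs (sp z1 x - sp z2 x) <= d /\ Rabs (sr z1 x - sr z2 x) <= d.

(** [sobolev] handles [su] and [sm], the weighted part of [near] handles [sp] and [sr]; k <= 1/2
    absorbs the factor 2 of [sobolev]. *)
Lemma near_close (k b : R) (z1 z2 : state) : 0 < k <= / 2 -> 0 <= b ->
  reg z1 -> reg z2 -> curve z1 -> curve z2 ->
  near (k ^ 2) (b ^ 2) z1 z2 -> close (b / k) z1 z2.
Proof.
  intros Hk Hb A1 A2 [D1 D1'] [D2 D2'] [N1 N2] x.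
  destruct A1, A2.
  assert (Hce : continuity (dist2 z1 z2)) by (unfold dist2; cont).
  assert (Hk2 : k ^ 2 <= / 4) by nra.
  assert (Hkp : 0 < k ^ 2) by (apply pow_lt; lra).
  assert (Hbk : 0 <= b / k) by (apply Rmult_le_pos; [lra | left; apply Rinv_0_lt_compat; lra]).
  assert (Hsq : forall v, k ^ 2 * v ^ 2 <= b ^ 2 -> Rabs v <= b / k).
  { intros v Hv; apply (Rmult_le_reg_l k); [lra|].
    replace (k * (b / k)) with b by (field; lra).
    destruct (Rle_lt_dec (k * Rabs v) b) as [|Hlt]; [assumption|exfalso].
    rewrite <- (pow2_abs v) in Hv; nra. }
  assert (Hu : (su z1 x - su z2 x) ^ 2 <= 2 * b ^ 2).
  { eapply Rle_trans;
      [apply (sobolev (fun y => su z1 y - su z2 y) (fun y => sp z1 y - sp z2 y) x)|].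
    - intros y; rewrite reg_pu0, reg_pu1; reflexivity.
    - cont.
    - intros y; der; reflexivity.
    - apply Rmult_le_compat_l; [lra|]; eapply Rle_trans; [|exact N1].
      apply mean_le; [cont|exact Hce|]; intros y; unfold dist2.
      assert (T1 := pow2_ge_0 (sm z1 y - sm z2 y)); assert (T2 := pow2_ge_0 (sr z1 y - sr z2 y)).
      lra. }
  assert (Hm : (sm z1 x - sm z2 x) ^ 2 <= 2 * b ^ 2).
  { eapply Rle_trans;
      [apply (sobolev (fun y => sm z1 y - sm z2 y) (fun y => sr z1 y - sr z2 y) x)|].
    - intros y; rewrite reg_pm0, reg_pm1; reflexivity.
    - cont.
    - intros y; der; reflexivity.
    - apply Rmult_le_compat_l; [lra|]; eapply Rle_trans; [|exact N1].
      apply mean_le; [cont|exact Hce|]; intros y; unfold dist2.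
      assert (T1 := pow2_ge_0 (su z1 y - su z2 y)); assert (T2 := pow2_ge_0 (sp z1 y - sp z2 y)).
      lra. }
  specialize (N2 x).
  assert (T1 := pow2_ge_0 (sp z1 x - sp z2 x)); assert (T2 := pow2_ge_0 (sr z1 x - sr z2 x)).
  assert (T3 := pow2_ge_0 (su z1 x - su z2 x)); assert (T4 := pow2_ge_0 (sm z1 x - sm z2 x)).
  assert (T5 := pow2_ge_0 b).
  repeat split; apply Hsq; nra.
Qed.

Section Homotopy.

Variables (H H1 H2 V : R -> R) (alpha : R).
Hypothesis Halpha : 0 < alpha.
Hypothesis DH : forall p, is_derive H p (H1 p).
Hypothesis DH1 : forall p, is_derive H1 p (H2 p).
Hypothesis CH2 : continuity H2.
Hypothesis CV : continuity V.
Hypothesis PV : periodic1 V.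
Hypothesis Htangent : forall p q, H p + H1 p * (q - p) <= H q.

Lemma CH : continuity H.
Proof. exact (der_cont H H1 DH). Qed.

Lemma CH1 : continuity H1.
Proof. exact (der_cont H1 H2 DH1). Qed.

Lemma H1_mono (p q : R) : 0 <= (H1 p - H1 q) * (p - q).
Proof. assert (T1 := Htangent p q); assert (T2 := Htangent q p); lra. Qed.

(** With [srcP] below, the equations read (1 - d^2)(u - eps m) = [srcF] and (1 - d^2)(m + eps u - 1)
    = ([srcP])_x. *)
Definition srcF (eps lam : R) (z : state) (x : R) : R :=
  Rpower (sm z x) alpha - lam * (V x + H (sp z x)) - (1 - lam) * (1 + eps).

Definition srcP (lam : R) (z : state) (x : R) : R := lam * H1 (sp z x) * sm z x.

Lemma srcF_cont (eps lam : R) (z : state) : adm z -> continuity (srcF eps lam z).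
Proof.
  intros [[Cu Cm Cp Cr _ _ _ _] Hpos]; unfold srcF.
  assert (C1 := CH); assert (C2 := cont_Rpower (sm z) alpha Cm Hpos); cont.
Qed.

Lemma srcF_periodic (eps lam : R) (z : state) : adm z -> periodic1 (srcF eps lam z).
Proof.
  intros [[_ _ _ _ Pu Pm Pp Pr] _] x; unfold srcF; rewrite Pm, Pp, PV; reflexivity.
Qed.

Lemma srcP_cont (lam : R) (z : state) : adm z -> continuity (srcP lam z).
Proof.
  intros [[Cu Cm Cp Cr _ _ _ _] Hpos]; unfold srcP; assert (C1 := CH1); cont.
Qed.

Lemma srcP_periodic (lam : R) (z : state) : adm z -> periodic1 (srcP lam z).
Proof.
  intros [[_ _ _ _ Pu Pm Pp Pr] _] x; unfold srcP; rewrite Pm, Pp; reflexivity.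
Qed.

(* Problem 1 in integrated form, for [lam * H] and the potential
   [lam * V + (1 - lam) * (1 + eps)]; [sp] and [sr] stand for [u_x] and [m_x].
   At [lam = 0] the solution is [(u, m) = (0, 1)]. *)
Record sol (eps lam : R) (z : state) : Prop := Sol {
  sol_adm : adm z;
  sol_m : forall x, green (srcF eps lam z) x = su z x - eps * sm z x;
  sol_r : forall x, dgreen (srcF eps lam z) x = sp z x - eps * sr z x;
  sol_u : forall x, dgreen (srcP lam z) x = sm z x + eps * su z x - 1;
  sol_p : forall x, green (srcP lam z) x = sr z x + eps * sp z x + srcP lam z x }.

(** The matrix with rows (1, -eps) and (eps, 1) has determinant 1 + eps^2, so both functions are
    combinations of the two differentiable ones. *)
Lemma der_2x2 (f g : R -> R) (eps x a b : R) :
  is_derive (fun y => f y - eps * g y) x (a - eps * b) ->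
  is_derive (fun y => g y + eps * f y) x (b + eps * a) ->
  is_derive f x a /\ is_derive g x b.
Proof.
  intros D1 D2; assert (He : 1 + eps ^ 2 <> 0) by (assert (T := pow2_ge_0 eps); lra).
  split.
  - apply (der_ext
      (fun y => / (1 + eps ^ 2) * ((f y - eps * g y) + eps * (g y + eps * f y)))).
    { intros y; field; exact He. }
    eapply der_eq.
    + apply (der_mult (fun _ => / (1 + eps ^ 2))); [apply der_const|].
      apply (der_plus (fun y => f y - eps * g y)); [exact D1|].
      apply (der_mult (fun _ => eps)); [apply der_const | exact D2].
    + field; exact He.
  - apply (der_ext
      (fun y => / (1 + eps ^ 2) * ((g y + eps * f y) - eps * (f y - eps * g y)))).
    { intros y; field; exact He. }
    eapply der_eq.
    + apply (der_mult (fun _ => / (1 + eps ^ 2))); [apply der_const|].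
      apply (der_minus (fun y => g y + eps * f y)); [exact D2|].
      apply (der_mult (fun _ => eps)); [apply der_const | exact D1].
    + field; exact He.
Qed.

(** Since (green f)' = dgreen f and (dgreen f)' = green f - f, [sol_r] and [sol_p] say what the
    derivatives of the combinations in [sol_m] and [sol_u] are. *)
Lemma sol_curve (eps lam : R) (z : state) : sol eps lam z -> curve z.
Proof.
  intros [A Em Er Eu Ep].
  assert (D1 : forall x, is_derive (fun y => su z y - eps * sm z y) x (sp z x - eps * sr z x)).
  { intros x; apply (der_ext (green (srcF eps lam z))); [exact Em|].
    rewrite <- Er; apply green_derive; [apply srcF_cont, A | apply srcF_periodic, A]. }
  assert (D2 : forall x, is_derive (fun y => sm z y + eps * su z y) x (sr z x + eps * sp z x)).
  { intros x; apply (der_ext (fun y => dgreen (srcP lam z) y + 1)).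
    { intros y; rewrite Eu; ring. }
    assert (D := dgreen_derive (srcP lam z) (srcP_cont lam z A) (srcP_periodic lam z A)).
    der; rewrite Ep; ring. }
  split; intros x; apply (der_2x2 (su z) (sm z) eps x _ _ (D1 x) (D2 x)).
Qed.

(** * Lipschitz bounds and monotonicity of the sources *)

Lemma source_lipschitz (dl M R0 : R) : 0 < dl -> exists L, 0 <= L /\
  forall lam m1 m2 p1 p2, 0 <= lam <= 1 -> dl <= m1 <= M -> dl <= m2 <= M ->
    Rabs p1 <= R0 -> Rabs p2 <= R0 ->
    Rabs (Rpower m1 alpha - Rpower m2 alpha) <= L * Rabs (m1 - m2) /\
    lam * Rabs (H p1 - H p2) <= L * Rabs (p1 - p2) /\
    Rabs (lam * m1 * (H1 p1 - H1 p2)) <= L * Rabs (p1 - p2) /\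
    Rabs (lam * H1 p2) <= L.
Proof.
  intros Hdl.
  destruct (lipschitz_on (fun y => Rpower y alpha) (fun y => alpha * Rpower y (alpha - 1)) dl M)
    as [La [HLa La1]].
  { intros x Hx; apply is_derive_Reals, derivable_pt_lim_power; lra. }
  { intros x Hx; apply continuity_pt_continuous.
    apply (ex_derive_continuous (fun y => alpha * Rpower y (alpha - 1))).
    exists (0 * Rpower x (alpha - 1) + alpha * ((alpha - 1) * Rpower x (alpha - 1 - 1) * 1)).
    apply (der_mult (fun _ => alpha) (fun y => Rpower y (alpha - 1)) x); [apply der_const|].
    apply (der_Rpower (fun y => y) x 1 (alpha - 1)); [lra | apply der_id]. }
  destruct (lipschitz_on H H1 (- R0) R0) as [Lh [HLh Lh1]];
    [intros; apply DH | intros; apply CH1 |].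
  destruct (lipschitz_on H1 H2 (- R0) R0) as [Ll [HLl Ll1]];
    [intros; apply DH1 | intros; apply CH2 |].
  destruct (bounded_on H1 (- R0) R0) as [K [HK K1]]; [intros; apply CH1|].
  set (M' := Rabs M).
  assert (HM' := Rabs_pos M : 0 <= M').
  exists (La + Lh + M' * Ll + K); split.
  { assert (0 <= M' * Ll) by (apply Rmult_le_pos; assumption); lra. }
  intros lam m1 m2 p1 p2 Hlam Hm1 Hm2 Hp1 Hp2.
  apply Rabs_le_between in Hp1, Hp2.
  assert (HMM : M <= M') by apply Rle_abs.
  assert (HML : 0 <= M' * Ll) by (apply Rmult_le_pos; assumption).
  specialize (La1 m1 m2 Hm1 Hm2); specialize (Lh1 p1 p2 Hp1 Hp2);
    specialize (Ll1 p1 p2 Hp1 Hp2); specialize (K1 p2 Hp2).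
  assert (Tm := Rabs_pos (m1 - m2)); assert (Tp := Rabs_pos (p1 - p2)).
  repeat split.
  - eapply Rle_trans; [exact La1|]; apply Rmult_le_compat_r; lra.
  - assert (Tq := Rabs_pos (H p1 - H p2)).
    apply Rle_trans with (Rabs (H p1 - H p2)); [nra|].
    eapply Rle_trans; [exact Lh1|]; apply Rmult_le_compat_r; lra.
  - rewrite Rabs_mult, (Rabs_pos_eq (lam * m1)) by (apply Rmult_le_pos; lra).
    apply Rle_trans with (M' * Rabs (H1 p1 - H1 p2)).
    + apply Rmult_le_compat_r; [apply Rabs_pos | nra].
    + apply Rle_trans with (M' * (Ll * Rabs (p1 - p2))).
      * apply Rmult_le_compat_l; [exact HM' | exact Ll1].
      * rewrite <- Rmult_assoc; apply Rmult_le_compat_r; lra.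
  - rewrite Rabs_mult, (Rabs_pos_eq lam) by lra; assert (Tq := Rabs_pos (H1 p2)); nra.
Qed.

Lemma Rpower_mono (m1 m2 : R) : 0 < m1 -> 0 < m2 ->
  0 <= (Rpower m1 alpha - Rpower m2 alpha) * (m1 - m2).
Proof.
  intros Hm1 Hm2; destruct (Rle_lt_dec m1 m2) as [Hm|Hm].
  - assert (Rpower m1 alpha <= Rpower m2 alpha) by (apply Rle_Rpower_l; lra); nra.
  - assert (Rpower m2 alpha <= Rpower m1 alpha) by (apply Rle_Rpower_l; lra); nra.
Qed.

(* Convexity of [H] makes [m * H p] convex in [p] and linear in [m], hence its
   skew gradient is monotone. *)
Lemma source_mono (lam m1 m2 p1 p2 : R) : 0 <= lam -> 0 < m1 -> 0 < m2 ->
  0 <= (Rpower m1 alpha - Rpower m2 alpha - lam * (H p1 - H p2)) * (m1 - m2)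
       + (lam * H1 p1 * m1 - lam * H1 p2 * m2) * (p1 - p2).
Proof.
  intros Hlam Hm1 Hm2; assert (T0 := Rpower_mono m1 m2 Hm1 Hm2).
  assert (T1 : 0 <= lam * (m1 * (H p2 - (H p1 + H1 p1 * (p2 - p1))))).
  { assert (T := Htangent p1 p2); repeat apply Rmult_le_pos; lra. }
  assert (T2 : 0 <= lam * (m2 * (H p1 - (H p2 + H1 p2 * (p1 - p2))))).
  { assert (T := Htangent p2 p1); repeat apply Rmult_le_pos; lra. }
  lra.
Qed.

(** The last clause serves the sup estimate, where the monotonicity of the coupled pair cannot be
    used: [k] is the change of flux due to [sp] alone and has the sign of the change of [sp], while
    [c] multiplies a change of [sm], which the energy controls. *)
Definition source_bounds (eps lam L : R) (z1 z2 : state) : Prop := forall x,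
  Rabs (srcF eps lam z1 x - srcF eps lam z2 x)
    <= L * (Rabs (sm z1 x - sm z2 x) + Rabs (sp z1 x - sp z2 x)) /\
  Rabs (srcP lam z1 x - srcP lam z2 x)
    <= L * (Rabs (sm z1 x - sm z2 x) + Rabs (sp z1 x - sp z2 x)) /\
  exists k c, srcP lam z1 x - srcP lam z2 x = k + c * (sm z1 x - sm z2 x) /\
    0 <= k * (sp z1 x - sp z2 x) /\ Rabs k <= L * Rabs (sp z1 x - sp z2 x) /\ Rabs c <= L.

Lemma source_bounds_box (dl M R0 : R) : 0 < dl -> exists L, 0 <= L /\
  forall eps lam z1 z2, 0 <= lam <= 1 -> box dl M R0 z1 -> box dl M R0 z2 ->
    source_bounds eps lam L z1 z2.
Proof.
  intros Hdl; destruct (source_lipschitz dl M R0 Hdl) as [L [HL0 HL]].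
  exists L; split; [exact HL0|]; intros eps lam z1 z2 Hlam B1 B2 x.
  destruct (B1 x) as [Hm1 Hp1]; destruct (B2 x) as [Hm2 Hp2].
  destruct (HL lam _ _ _ _ Hlam Hm1 Hm2 Hp1 Hp2) as [L1 [L2 [L3 L4]]].
  unfold srcF, srcP.
  set (m1 := sm z1 x) in *; set (m2 := sm z2 x) in *;
  set (p1 := sp z1 x) in *; set (p2 := sp z2 x) in *.
  assert (E : lam * H1 p1 * m1 - lam * H1 p2 * m2
              = lam * m1 * (H1 p1 - H1 p2) + lam * H1 p2 * (m1 - m2)) by ring.
  repeat split.
  - replace (_ - _) with ((Rpower m1 alpha - Rpower m2 alpha) - lam * (H p1 - H p2)) by ring.
    eapply Rle_trans; [apply Rabs_triang|].
    rewrite Rabs_Ropp, Rabs_mult, (Rabs_pos_eq lam) by lra; lra.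
  - rewrite E; eapply Rle_trans; [apply Rabs_triang|].
    rewrite (Rabs_mult (lam * H1 p2)).
    assert (Rabs (lam * H1 p2) * Rabs (m1 - m2) <= L * Rabs (m1 - m2))
      by (apply Rmult_le_compat_r; [apply Rabs_pos | exact L4]); lra.
  - exists (lam * m1 * (H1 p1 - H1 p2)), (lam * H1 p2); repeat split; try assumption.
    rewrite Rmult_assoc; apply Rmult_le_pos; [apply Rmult_le_pos; lra | apply H1_mono].
Qed.

(** An explicit step: [su] moves by the residual of [sol_u], [sm] by that of [sol_m], and along a
    [curve] the last two components are the derivatives of the first two. *)
Definition relax (eps lam tau : R) (z : state) : state := State
  (fun x => su z x - tau * (sm z x + eps * su z x - 1 - dgreen (srcP lam z) x))
  (fun x => sm z x - tau * (green (srcF eps lam z) x - (su z x - eps * sm z x)))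
  (fun x => sp z x - tau * (sr z x + eps * sp z x - green (srcP lam z) x + srcP lam z x))
  (fun x => sr z x - tau * (dgreen (srcF eps lam z) x - (sp z x - eps * sr z x))).

Lemma relax_reg (eps lam tau : R) (z : state) : adm z -> reg (relax eps lam tau z).
Proof.
  intros A.
  assert (CF := srcF_cont eps lam z A); assert (PF := srcF_periodic eps lam z A).
  assert (CP := srcP_cont lam z A); assert (PP := srcP_periodic lam z A).
  assert (G1 := green_cont _ CF PF); assert (G2 := dgreen_cont _ CF PF).
  assert (G3 := green_cont _ CP PP); assert (G4 := dgreen_cont _ CP PP).
  assert (Q1 := green_periodic _ CF PF); assert (Q2 := dgreen_periodic _ CF PF).
  assert (Q3 := green_periodic _ CP PP); assert (Q4 := dgreen_periodic _ CP PP).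
  destruct A as [[Cu Cm Cp Cr Pu Pm Pp Pr] _].
  constructor; simpl; try solve [cont]; intros x;
    rewrite ?Pu, ?Pm, ?Pp, ?Pr, ?Q1, ?Q2, ?Q3, ?Q4, ?PP; reflexivity.
Qed.

Lemma relax_curve (eps lam tau : R) (z : state) : adm z -> curve z ->
  curve (relax eps lam tau z).
Proof.
  intros A [D1 D2].
  assert (G1 := green_derive _ (srcF_cont eps lam z A) (srcF_periodic eps lam z A)).
  assert (G2 := dgreen_derive _ (srcP_cont lam z A) (srcP_periodic lam z A)).
  split; intros x; simpl; der; ring.
Qed.

(** With s = tau eps / 2, the sup part contracts by 1 - s up to [K] times the energy. The weight
    [kap] is so small that this excess costs s / 2, which leaves the common factor 1 - s / 2. *)
Lemma relax_near (eps lam tau L kap a : R) (z1 z2 : state) :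
  0 < eps <= 1 -> 0 <= lam -> 0 < tau -> tau * (8 + 136 * L ^ 2) <= eps ->
  0 <= kap -> tau * eps / 2 <= 1 ->
  kap * ((1 + / (tau * eps / 2)) * tau ^ 2 * (28 * L ^ 2)) <= tau * eps / 2 / 2 ->
  adm z1 -> adm z2 -> curve z1 -> curve z2 -> source_bounds eps lam L z1 z2 ->
  near kap a z1 z2 ->
  near kap ((1 - tau * eps / 2 / 2) * a) (relax eps lam tau z1) (relax eps lam tau z2).
Proof.
  intros Heps Hlam Htau HtL Hkap Hs1 HkK A1 A2 [D1 D1'] [D2 D2'] HB [N1 N2].
  set (s := tau * eps / 2) in *.
  set (K := (1 + / s) * tau ^ 2 * (28 * L ^ 2)) in *.
  assert (Hs : 0 < s) by (unfold s; assert (0 < tau * eps) by (apply Rmult_lt_0_compat; lra); lra).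
  assert (HKp : 0 <= K).
  { unfold K; assert (0 < / s) by (apply Rinv_0_lt_compat, Hs).
    assert (T := pow2_ge_0 tau); assert (T' := pow2_ge_0 L).
    apply Rmult_le_pos; [apply Rmult_le_pos|]; lra. }
  assert (CF1 := srcF_cont eps lam z1 A1); assert (CF2 := srcF_cont eps lam z2 A2).
  assert (CP1 := srcP_cont lam z1 A1); assert (CP2 := srcP_cont lam z2 A2).
  assert (PF1 := srcF_periodic eps lam z1 A1); assert (PF2 := srcF_periodic eps lam z2 A2).
  assert (PP1 := srcP_periodic lam z1 A1); assert (PP2 := srcP_periodic lam z2 A2).
  set (du := fun x => su z1 x - su z2 x); set (dm := fun x => sm z1 x - sm z2 x).
  set (dp := fun x => sp z1 x - sp z2 x); set (dr := fun x => sr z1 x - sr z2 x).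
  set (dF := fun x => srcF eps lam z1 x - srcF eps lam z2 x).
  set (dP := fun x => srcP lam z1 x - srcP lam z2 x).
  assert (Hmono : forall x, 0 <= dF x * dm x + dP x * dp x).
  { intros x; unfold dF, dP, dm, dp, srcF, srcP.
    eapply Rle_trans;
      [apply (source_mono lam (sm z1 x) (sm z2 x) (sp z1 x) (sp z2 x) Hlam);
        [apply (adm_pos z1 A1) | apply (adm_pos z2 A2)] | right; ring]. }
  assert (HF : forall x, Rabs (dF x) <= L * (Rabs (dm x) + Rabs (dp x))) by apply HB.
  assert (HP : forall x, Rabs (dP x) <= L * (Rabs (dm x) + Rabs (dp x))) by apply HB.
  assert (HS : forall x, exists k c, dP x = k + c * dm x /\
    0 <= k * dp x /\ Rabs k <= L * Rabs (dp x) /\ Rabs c <= L) by apply HB.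
  assert (Pu : periodic1 du) by (intros x; unfold du; rewrite (reg_pu z1 (adm_reg z1 A1)), (reg_pu z2 (adm_reg z2 A2)); reflexivity).
  assert (Pm : periodic1 dm) by (intros x; unfold dm; rewrite (reg_pm z1 (adm_reg z1 A1)), (reg_pm z2 (adm_reg z2 A2)); reflexivity).
  assert (PdF : periodic1 dF) by (intros x; unfold dF; rewrite PF1, PF2; reflexivity).
  assert (PdP : periodic1 dP) by (intros x; unfold dP; rewrite PP1, PP2; reflexivity).
  assert (Cp : continuity dp).
  { apply cont_minus; [apply (reg_cp z1 (adm_reg z1 A1)) | apply (reg_cp z2 (adm_reg z2 A2))]. }
  assert (Cr : continuity dr).
  { apply cont_minus; [apply (reg_cr z1 (adm_reg z1 A1)) | apply (reg_cr z2 (adm_reg z2 A2))]. }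
  assert (CdF : continuity dF) by (unfold dF; cont).
  assert (CdP : continuity dP) by (unfold dP; cont).
  assert (Du : forall x, is_derive du x (dp x)) by (intros x; unfold du, dp; der; reflexivity).
  assert (Dm : forall x, is_derive dm x (dr x)) by (intros x; unfold dm, dr; der; reflexivity).
  assert (EG : forall x, green (srcF eps lam z1) x - green (srcF eps lam z2) x = green dF x).
  { intros x; symmetry; apply green_minus; assumption. }
  assert (ED : forall x, dgreen (srcF eps lam z1) x - dgreen (srcF eps lam z2) x = dgreen dF x).
  { intros x; symmetry; apply dgreen_minus; assumption. }
  assert (EG' : forall x, green (srcP lam z1) x - green (srcP lam z2) x = green dP x).
  { intros x; symmetry; apply green_minus; assumption. }
  assert (ED' : forall x, dgreen (srcP lam z1) x - dgreen (srcP lam z2) x = dgreen dP x).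
  { intros x; symmetry; apply dgreen_minus; assumption. }
  assert (Ep : forall x, sp (relax eps lam tau z1) x - sp (relax eps lam tau z2) x
     = dp x - tau * (dr x + eps * dp x - green dP x + dP x)).
  { intros x; rewrite <- EG'; unfold dp, dr, dP; simpl; ring. }
  assert (Er : forall x, sr (relax eps lam tau z1) x - sr (relax eps lam tau z2) x
     = dr x - tau * (dgreen dF x - (dp x - eps * dr x))).
  { intros x; rewrite <- ED; unfold dp, dr; simpl; ring. }
  assert (Eu : forall x, su (relax eps lam tau z1) x - su (relax eps lam tau z2) x
     = du x - tau * (dm x + eps * du x - dgreen dP x)).
  { intros x; rewrite <- ED'; unfold du, dm; simpl; ring. }
  assert (Em : forall x, sm (relax eps lam tau z1) x - sm (relax eps lam tau z2) x
     = dm x - tau * (green dF x - (du x - eps * dm x))).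
  { intros x; rewrite <- EG; unfold du, dm; simpl; ring. }
  assert (HE := contraction_energy eps tau L du dm dp dr dF dP Heps Htau HtL
    Pu Pm PdF PdP Cp Cr CdF CdP Du Dm HF HP Hmono).
  assert (HW := contraction_pointwise eps tau L du dm dp dr dF dP Heps Htau HtL
    Pm PdF PdP Cp Cr CdF CdP Du Dm HF HP HS).
  change (mean (fun x => du x ^ 2 + dm x ^ 2 + dp x ^ 2 + dr x ^ 2))
    with (mean (dist2 z1 z2)) in HE, HW.
  assert (HE0 : 0 <= mean (dist2 z1 z2)).
  { rewrite <- (mean_const 0); apply mean_le; [cont| |].
    - destruct A1 as [[] _], A2 as [[] _]; unfold dist2; cont.
    - intros x; unfold dist2; assert (T1 := pow2_ge_0 (su z1 x - su z2 x));
      assert (T2 := pow2_ge_0 (sm z1 x - sm z2 x)); assert (T3 := pow2_ge_0 (sp z1 x - sp z2 x));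
      assert (T4 := pow2_ge_0 (sr z1 x - sr z2 x)); lra. }
  split.
  - unfold dist2 at 1.
    rewrite (mean_ext _ _ (fun x => f_equal2 Rplus (f_equal2 Rplus (f_equal2 Rplus
      (f_equal (fun t => t ^ 2) (Eu x)) (f_equal (fun t => t ^ 2) (Em x)))
      (f_equal (fun t => t ^ 2) (Ep x))) (f_equal (fun t => t ^ 2) (Er x)))).
    eapply Rle_trans; [exact HE|].
    replace (tau * eps) with (2 * s) by (unfold s; field); nra.
  - intros x; rewrite Ep, Er; specialize (HW x); specialize (N2 x).
    fold s in HW; fold K in HW.
    apply (Rmult_le_compat_l kap) in HW; [|exact Hkap].
    eapply Rle_trans; [exact HW|].
    change (kap * (dp x ^ 2 + dr x ^ 2) <= a) in N2.
    assert (B1 : (1 - s) * (kap * (dp x ^ 2 + dr x ^ 2)) <= (1 - s) * a)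
      by (apply Rmult_le_compat_l; lra).
    assert (B2 : kap * K * mean (dist2 z1 z2) <= s / 2 * a).
    { apply Rmult_le_compat; try assumption; apply Rmult_le_pos; assumption. }
    lra.
Qed.

(** Sup-norm continuity without contraction, for passing to the limit. Sources change by at most 2 L
    d, their Green transforms by 4 L d, and the local flux adds 2 L d, whence the 6 L. *)
Lemma relax_close (eps lam tau L d : R) (z1 z2 : state) :
  0 < eps <= 1 -> 0 < tau <= 1 -> 0 <= L -> adm z1 -> adm z2 ->
  source_bounds eps lam L z1 z2 -> close d z1 z2 ->
  close ((3 + 6 * L) * d) (relax eps lam tau z1) (relax eps lam tau z2).
Proof.
  intros Heps Htau HL A1 A2 HB HC x.
  assert (CF1 := srcF_cont eps lam z1 A1); assert (CF2 := srcF_cont eps lam z2 A2).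
  assert (CP1 := srcP_cont lam z1 A1); assert (CP2 := srcP_cont lam z2 A2).
  assert (PF1 := srcF_periodic eps lam z1 A1); assert (PF2 := srcF_periodic eps lam z2 A2).
  assert (PP1 := srcP_periodic lam z1 A1); assert (PP2 := srcP_periodic lam z2 A2).
  set (dF := fun x => srcF eps lam z1 x - srcF eps lam z2 x).
  set (dP := fun x => srcP lam z1 x - srcP lam z2 x).
  assert (CdF : continuity dF) by (unfold dF; cont).
  assert (CdP : continuity dP) by (unfold dP; cont).
  assert (PdF : periodic1 dF) by (intros y; unfold dF; rewrite PF1, PF2; reflexivity).
  assert (PdP : periodic1 dP) by (intros y; unfold dP; rewrite PP1, PP2; reflexivity).
  assert (Hd : forall y, Rabs (dF y) <= 2 * L * d /\ Rabs (dP y) <= 2 * L * d).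
  { intros y; destruct (HB y) as [B1 [B2 _]]; destruct (HC y) as [_ [C1 [C2 _]]].
    fold (dF y) in B1; fold (dP y) in B2.
    assert (L * (Rabs (sm z1 y - sm z2 y) + Rabs (sp z1 y - sp z2 y)) <= L * (d + d))
      by (apply Rmult_le_compat_l; lra).
    lra. }
  destruct (green_bound_sup dF CdF PdF (2 * L * d) x) as [B1 B2]; [apply Hd|].
  destruct (green_bound_sup dP CdP PdP (2 * L * d) x) as [B3 B4]; [apply Hd|].
  destruct (Hd x) as [_ B5].
  unfold dF in B1, B2; unfold dP in B3, B4, B5.
  rewrite green_minus in B1, B3 by assumption; rewrite dgreen_minus in B2, B4 by assumption.
  destruct (HC x) as [C1 [C2 [C3 C4]]].
  assert (Hd0 : 0 <= d) by (assert (T := Rabs_pos (su z1 x - su z2 x)); lra).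
  assert (HLd : 0 <= L * d) by (apply Rmult_le_pos; assumption).
  assert (Hcomb : forall a e, Rabs a <= d -> Rabs e <= (2 + 6 * L) * d ->
    Rabs (a - tau * e) <= (3 + 6 * L) * d).
  { intros a e Ha He; eapply Rle_trans; [apply Rabs_triang|].
    rewrite Rabs_Ropp, Rabs_mult, (Rabs_pos_eq tau) by lra.
    assert (T := Rabs_pos e); nra. }
  assert (Hsc : forall a, Rabs a <= d -> Rabs (eps * a) <= d).
  { intros a Ha; rewrite Rabs_mult, (Rabs_pos_eq eps) by lra; assert (T := Rabs_pos a); nra. }
  assert (S1 := Hsc _ C1); assert (S2 := Hsc _ C2); assert (S3 := Hsc _ C3); assert (S4 := Hsc _ C4).
  apply Rabs_le_between in B1, B2, B3, B4, B5, S1, S2, S3, S4.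
  assert (C1' := C1); assert (C2' := C2); assert (C3' := C3); assert (C4' := C4).
  apply Rabs_le_between in C1', C2', C3', C4'.
  simpl; repeat split.
  - eapply Rle_trans; [|apply (Hcomb (su z1 x - su z2 x)
      ((sm z1 x - sm z2 x) + eps * (su z1 x - su z2 x)
        - (dgreen (srcP lam z1) x - dgreen (srcP lam z2) x))); [exact C1|]].
    + right; f_equal; ring.
    + apply Rabs_le_between; lra.
  - eapply Rle_trans; [|apply (Hcomb (sm z1 x - sm z2 x)
      ((green (srcF eps lam z1) x - green (srcF eps lam z2) x)
       - (su z1 x - su z2 x) + eps * (sm z1 x - sm z2 x))); [exact C2|]].
    + right; f_equal; ring.
    + apply Rabs_le_between; lra.
  - eapply Rle_trans; [|apply (Hcomb (sp z1 x - sp z2 x)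
      ((sr z1 x - sr z2 x) + eps * (sp z1 x - sp z2 x)
       - (green (srcP lam z1) x - green (srcP lam z2) x)
       + (srcP lam z1 x - srcP lam z2 x))); [exact C3|]].
    + right; f_equal; ring.
    + apply Rabs_le_between; lra.
  - eapply Rle_trans; [|apply (Hcomb (sr z1 x - sr z2 x)
      ((dgreen (srcF eps lam z1) x - dgreen (srcF eps lam z2) x)
       - (sp z1 x - sp z2 x) + eps * (sr z1 x - sr z2 x))); [exact C4|]].
    + right; f_equal; ring.
    + apply Rabs_le_between; lra.
Qed.

Lemma relax_fixed (eps lam tau C b : R) (z : state) : 0 < tau -> 0 <= b < 1 -> adm z ->
  (forall n, close (C * b ^ n) (relax eps lam tau z) z) -> sol eps lam z.
Proof.
  intros Ht Hb A HC.
  assert (E : forall a e, (forall n, Rabs (a - tau * e - a) <= C * b ^ n) -> e = 0).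
  { intros a e He; apply (geometric_zero _ C b Hb) in He.
    apply (Rmult_eq_reg_l tau); lra. }
  constructor; [exact A | | | |]; intros x.
  - assert (Z := E _ _ (fun n => proj1 (proj2 (HC n x)))); simpl in Z; lra.
  - assert (Z := E _ _ (fun n => proj2 (proj2 (proj2 (HC n x))))); simpl in Z; lra.
  - assert (Z := E _ _ (fun n => proj1 (HC n x))); simpl in Z; lra.
  - assert (Z := E _ _ (fun n => proj1 (proj2 (proj2 (HC n x))))); simpl in Z; lra.
Qed.

(** At a solution for [lam] the residual for [lam'] consists of source differences only, and these
    are linear in lam' - lam. Of the factor 3, two come from the Green operator and one from the
    local flux. *)
Lemma relax_initial (eps lam lam' tau Q : R) (z : state) :
  0 < tau <= 1 -> 0 <= Q -> sol eps lam z ->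
  (forall x, Rabs (1 + eps - (V x + H (sp z x))) <= Q) ->
  (forall x, Rabs (H1 (sp z x) * sm z x) <= Q) ->
  close (3 * (Rabs (lam' - lam) * Q)) (relax eps lam' tau z) z.
Proof.
  intros Ht HQ [A Em Er Eu Ep] HF HP x.
  assert (CF1 := srcF_cont eps lam' z A); assert (CF2 := srcF_cont eps lam z A).
  assert (CP1 := srcP_cont lam' z A); assert (CP2 := srcP_cont lam z A).
  assert (PF1 := srcF_periodic eps lam' z A); assert (PF2 := srcF_periodic eps lam z A).
  assert (PP1 := srcP_periodic lam' z A); assert (PP2 := srcP_periodic lam z A).
  set (d := Rabs (lam' - lam) * Q).
  set (dF := fun x => srcF eps lam' z x - srcF eps lam z x).
  set (dP := fun x => srcP lam' z x - srcP lam z x).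
  assert (CdF : continuity dF) by (unfold dF; cont).
  assert (CdP : continuity dP) by (unfold dP; cont).
  assert (PdF : periodic1 dF) by (intros y; unfold dF; rewrite PF1, PF2; reflexivity).
  assert (PdP : periodic1 dP) by (intros y; unfold dP; rewrite PP1, PP2; reflexivity).
  assert (HdF : forall y, Rabs (dF y) <= d).
  { intros y; unfold dF, srcF, d.
    replace (_ - _) with ((lam' - lam) * (1 + eps - (V y + H (sp z y)))) by ring.
    rewrite Rabs_mult; apply Rmult_le_compat_l; [apply Rabs_pos | apply HF]. }
  assert (HdP : forall y, Rabs (dP y) <= d).
  { intros y; unfold dP, srcP, d.
    replace (_ - _) with ((lam' - lam) * (H1 (sp z y) * sm z y)) by ring.
    rewrite Rabs_mult; apply Rmult_le_compat_l; [apply Rabs_pos | apply HP]. }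
  destruct (green_bound_sup dF CdF PdF d x HdF) as [B1 B2].
  destruct (green_bound_sup dP CdP PdP d x HdP) as [B3 B4].
  assert (B5 := HdP x).
  unfold dF in B1, B2; unfold dP in B3, B4, B5.
  rewrite green_minus in B1, B3 by assumption; rewrite dgreen_minus in B2, B4 by assumption.
  rewrite Em in B1; rewrite Er in B2; rewrite Ep in B3; rewrite Eu in B4.
  assert (Hd0 : 0 <= d) by (apply Rmult_le_pos; [apply Rabs_pos | exact HQ]).
  assert (Hcomb : forall a e, Rabs e <= 3 * d -> Rabs (a - tau * e - a) <= 3 * d).
  { intros a e He; replace (a - tau * e - a) with (- (tau * e)) by ring.
    rewrite Rabs_Ropp, Rabs_mult, (Rabs_pos_eq tau) by lra.
    assert (T := Rabs_pos e); nra. }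
  apply Rabs_le_between in B1, B2, B3, B4, B5.
  simpl; repeat split; apply Hcomb, Rabs_le_between; lra.
Qed.

Lemma close_near (kap c : R) (z1 z2 : state) : 0 <= kap <= 1 -> reg z1 -> reg z2 ->
  close c z1 z2 -> near kap ((2 * c) ^ 2) z1 z2.
Proof.
  intros Hk [] [] HC; split.
  - rewrite <- (mean_const ((2 * c) ^ 2)); apply mean_le; [unfold dist2; cont | cont |].
    intros x; unfold dist2; destruct (HC x) as [C1 [C2 [C3 C4]]].
    apply sq_abs_le in C1, C2, C3, C4; lra.
  - intros x; destruct (HC x) as [_ [_ [C3 C4]]].
    apply sq_abs_le in C3, C4.
    assert (T1 := pow2_ge_0 (sp z1 x - sp z2 x)); assert (T2 := pow2_ge_0 (sr z1 x - sr z2 x)).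
    nra.
Qed.

Lemma near_weaken (kap a a' : R) (z1 z2 : state) : a <= a' ->
  near kap a z1 z2 -> near kap a' z1 z2.
Proof. intros Ha [N1 N2]; split; [lra | intros x; specialize (N2 x); lra]. Qed.

Lemma close_box (dl M R0 c : R) (z0 z : state) : c <= dl / 2 -> c <= 1 ->
  box dl M R0 z0 -> close c z z0 -> box (dl / 2) (M + 1) (R0 + 1) z.
Proof.
  intros Hc1 Hc2 B HC x; destruct (B x) as [Bm Bp]; destruct (HC x) as [_ [Cm [Cp _]]].
  apply Rabs_le_between in Bp, Cm, Cp; split; [lra|]; apply Rabs_le_between; lra.
Qed.

(** * One continuation step in [lam] *)

Lemma homotopy_step (eps dl M R0 : R) : 0 < eps <= 1 -> 0 < dl -> exists eta, 0 < eta /\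
  forall lam lam' z, 0 <= lam' <= 1 -> Rabs (lam' - lam) <= eta ->
    sol eps lam z -> box dl M R0 z -> exists z', sol eps lam' z'.
Proof.
  intros Heps Hdl.
  (* The Lipschitz constant is taken on an enlarged box, which leaves the iterates room to move. *)
  destruct (source_bounds_box (dl / 2) (M + 1) (R0 + 1)) as [L [HL0 HL]]; [lra|].
  set (tau := eps / (8 + 136 * L ^ 2)).
  assert (TL := pow2_ge_0 L).
  assert (Htau : 0 < tau).
  { apply Rmult_lt_0_compat; [lra | apply Rinv_0_lt_compat; lra]. }
  assert (HtL : tau * (8 + 136 * L ^ 2) = eps) by (unfold tau; field; lra).
  assert (Htau1 : tau <= / 8) by nra.
  set (s := tau * eps / 2).
  assert (Hs : 0 < s <= / 2).
  { assert (0 < tau * eps <= 1) by (split; [apply Rmult_lt_0_compat; lra | nra]); unfold s; lra. }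
  set (K := (1 + / s) * tau ^ 2 * (28 * L ^ 2)).
  assert (HK : 0 <= K).
  { unfold K; assert (0 < / s) by (apply Rinv_0_lt_compat; lra).
    assert (T := pow2_ge_0 tau); apply Rmult_le_pos; [apply Rmult_le_pos|]; lra. }
  (* [k ^ 2] is the weight [kap]; the two entries secure k <= 1/2 for [near_close] and k^2 K <= s /
     2 for [relax_near]. *)
  set (k := Rmin (/ 2) (s / (2 * (K + 1)))).
  assert (Hk : 0 < k <= / 2).
  { split; [|apply Rmin_l]; apply Rmin_glb_lt; [lra|].
    apply Rmult_lt_0_compat; [lra | apply Rinv_0_lt_compat; lra]. }
  assert (HkK : k ^ 2 * K <= s / 2).
  { assert (Hk2 : k <= s / (2 * (K + 1))) by apply Rmin_r.
    assert (Hkk : k ^ 2 <= k) by nra.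
    apply (Rmult_le_compat_r K) in Hkk; [|exact HK].
    apply (Rmult_le_compat_r (K + 1)) in Hk2; [|lra].
    replace (s / (2 * (K + 1)) * (K + 1)) with (s / 2) in Hk2 by (field; lra); lra. }
  (* [near] bounds squares, which shrink by 1 - s / 2 <= be^2 per step, so [be] is a rate for the
     distances themselves. *)
  set (be := 1 - s / 4).
  assert (Hbe : 0 <= be < 1) by (unfold be; lra).
  set (c := Rmin (dl / 2) 1).
  assert (Hc : 0 < c) by (apply Rmin_glb_lt; lra).
  assert (Hc1 : c <= dl / 2) by apply Rmin_l.
  assert (Hc2 : c <= 1) by apply Rmin_r.
  (* Chosen so that the successive sup distances c (1 - be) be^n add up to [c], the radius that
     [close_box] tolerates. *)
  set (b := c * k * (1 - be)).
  assert (Hb : 0 < b) by (unfold b; apply Rmult_lt_0_compat; [apply Rmult_lt_0_compat|]; lra).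
  assert (Hbk : b / k = c * (1 - be)) by (unfold b; field; lra).
  destruct (bounded_on H (- R0) R0) as [KH [HKH KH1]]; [intros; apply CH|].
  destruct (bounded_on H1 (- R0) R0) as [KH' [HKH' KH1']]; [intros; apply CH1|].
  destruct (periodic1_bounded V PV CV) as [KV [HKV KV1]].
  set (Q := 2 + KV + KH + KH' * Rabs M).
  assert (HKM : 0 <= KH' * Rabs M) by (apply Rmult_le_pos; [assumption | apply Rabs_pos]).
  assert (HQ : 0 < Q) by (unfold Q; lra).
  exists (b / (6 * Q)); split.
  { apply Rmult_lt_0_compat; [lra | apply Rinv_0_lt_compat; lra]. }
  intros lam lam' z0 Hlam' Hdlam S0 B0.
  assert (A0 := sol_adm _ _ _ S0).
  assert (Hinit : close (b / 2) (relax eps lam' tau z0) z0).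
  { assert (HC : close (3 * (Rabs (lam' - lam) * Q)) (relax eps lam' tau z0) z0).
    { apply relax_initial; try assumption; try lra; intros x; destruct (B0 x) as [Bm Bp];
        apply Rabs_le_between in Bp.
      - specialize (KH1 _ Bp); specialize (KV1 x); apply Rabs_le_between in KH1, KV1.
        apply Rabs_le_between; unfold Q; lra.
      - specialize (KH1' _ Bp); rewrite Rabs_mult.
        apply Rle_trans with (KH' * Rabs M); [|unfold Q; lra].
        apply Rmult_le_compat; try apply Rabs_pos; [exact KH1'|].
        rewrite !Rabs_pos_eq; lra. }
    assert (Hle : 3 * (Rabs (lam' - lam) * Q) <= b / 2).
    { apply (Rmult_le_compat_r Q) in Hdlam; [|lra].
      replace (b / (6 * Q) * Q) with (b / 6) in Hdlam by (field; lra); lra. }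
    intros x; destruct (HC x) as [X1 [X2 [X3 X4]]]; lra. }
  set (T := relax eps lam' tau).
  set (zn := fun n => Nat.iter n T z0).
  assert (Hpow : forall n, 0 <= be ^ n <= 1).
  { intros n; split; [apply pow_le; lra|]; rewrite <- (pow1 n); apply pow_incr; lra. }
  assert (Hnc : forall n, adm (zn n) -> curve (zn n) ->
    near (k ^ 2) ((b * be ^ n) ^ 2) (zn (S n)) (zn n) ->
    close (c * (1 - be) * be ^ n) (zn (S n)) (zn n)).
  { intros n A C N.
    replace (c * (1 - be) * be ^ n) with (b * be ^ n / k)
      by (unfold b; field; lra).
    apply near_close; try assumption.
    - apply Rmult_le_pos; [lra | apply Hpow].
    - apply relax_reg, A.
    - apply A.
    - apply relax_curve; assumption. }
  (* These must be proved together: contraction needs both iterates in the enlarged box, and staying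
     in the box needs the sum of all earlier steps. *)
  assert (Hind : forall n, adm (zn n) /\ curve (zn n) /\ close (c * (1 - be ^ n)) (zn n) z0 /\
    near (k ^ 2) ((b * be ^ n) ^ 2) (zn (S n)) (zn n)).
  { induction n as [|n [A [C [HC N]]]].
    - split; [exact A0|]; split; [apply (sol_curve _ _ _ S0)|]; split.
      + intros x; simpl; rewrite !Rminus_diag, !Rabs_R0; lra.
      + simpl pow; rewrite Rmult_1_r.
        apply (near_weaken _ ((2 * (b / 2)) ^ 2)); [right; simpl; field|].
        apply close_near; [nra | apply relax_reg, A0 | apply A0 | exact Hinit].
    - assert (HC1 := Hnc n A C N).
      assert (HC2 : close (c * (1 - be ^ S n)) (zn (S n)) z0).
      { assert (E : c * (1 - be ^ S n) = c * (1 - be) * be ^ n + c * (1 - be ^ n))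
          by (simpl; ring).
        rewrite E; intros x; destruct (HC x) as [X1 [X2 [X3 X4]]];
          destruct (HC1 x) as [Y1 [Y2 [Y3 Y4]]].
        apply Rabs_le_between in X1, X2, X3, X4, Y1, Y2, Y3, Y4.
        repeat split; apply Rabs_le_between; lra. }
      assert (Hbox : forall j, close (c * (1 - be ^ j)) (zn j) z0 ->
        box (dl / 2) (M + 1) (R0 + 1) (zn j)).
      { intros j Hj; apply (close_box dl M R0 (c * (1 - be ^ j)) z0);
          try assumption; specialize (Hpow j); nra. }
      assert (BN := Hbox n HC); assert (BS := Hbox (S n) HC2).
      assert (AS : adm (zn (S n))).
      { constructor; [apply relax_reg, A | intros x; destruct (BS x); lra]. }
      assert (CS : curve (zn (S n))) by (apply relax_curve; assumption).
      split; [exact AS|]; split; [exact CS|]; split; [exact HC2|].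
      apply (near_weaken _ ((1 - s / 2) * (b * be ^ n) ^ 2)).
      + replace ((b * be ^ S n) ^ 2) with (be ^ 2 * (b * be ^ n) ^ 2) by (simpl; ring).
        apply Rmult_le_compat_r; [apply pow2_ge_0|]; unfold be; nra.
      + apply (relax_near eps lam' tau L); try assumption; try lra.
        * apply pow2_ge_0.
        * fold s; lra.
        * apply HL; assumption. }
  assert (Hstep : forall n, close (c * (1 - be) * be ^ n) (zn (S n)) (zn n)).
  { intros n; destruct (Hind n) as [A [C [_ N]]]; apply Hnc; assumption. }
  assert (Hcc : 0 <= c * (1 - be)) by (apply Rmult_le_pos; lra).
  assert (Hcd : c * (1 - be) / (1 - be) = c) by (field; lra).
  destruct (geometric_limit (fun n => su (zn n)) (c * (1 - be)) be Hbe Hcc) as [gu [Cu Gu]];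
    [intros n; apply (Hind n) | intros n x; apply (Hstep n x) |].
  destruct (geometric_limit (fun n => sm (zn n)) (c * (1 - be)) be Hbe Hcc) as [gm [Cm Gm]];
    [intros n; apply (Hind n) | intros n x; apply (Hstep n x) |].
  destruct (geometric_limit (fun n => sp (zn n)) (c * (1 - be)) be Hbe Hcc) as [gp [Cp Gp]];
    [intros n; apply (Hind n) | intros n x; apply (Hstep n x) |].
  destruct (geometric_limit (fun n => sr (zn n)) (c * (1 - be)) be Hbe Hcc) as [gr [Cr Gr]];
    [intros n; apply (Hind n) | intros n x; apply (Hstep n x) |].
  rewrite Hcd in Gu, Gm, Gp, Gr.
  set (z := State gu gm gp gr).
  assert (Hclose : forall n, close (c * be ^ n) (zn n) z).
  { intros n x; simpl; auto. }
  assert (Rz : reg z).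
  { constructor; simpl; try assumption.
    - apply (limit_periodic (fun n => su (zn n)) gu c be Hbe); [intros n; apply (Hind n)|exact Gu].
    - apply (limit_periodic (fun n => sm (zn n)) gm c be Hbe); [intros n; apply (Hind n)|exact Gm].
    - apply (limit_periodic (fun n => sp (zn n)) gp c be Hbe); [intros n; apply (Hind n)|exact Gp].
    - apply (limit_periodic (fun n => sr (zn n)) gr c be Hbe); [intros n; apply (Hind n)|exact Gr]. }
  assert (Bz : box (dl / 2) (M + 1) (R0 + 1) z).
  { apply (close_box dl M R0 c z0); try assumption.
    intros x; destruct (Hclose 0%nat x) as [X1 [X2 [X3 X4]]].
    simpl pow in X1, X2, X3, X4; rewrite Rmult_1_r in X1, X2, X3, X4.
    rewrite Rabs_minus_sym in X1, X2, X3, X4; auto. }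
  assert (Az : adm z) by (constructor; [exact Rz | intros x; destruct (Bz x); lra]).
  (* The two summands are the legs of a triangle through [zn (S n)]: [relax_close] from the relaxed
     [z], then the convergence rate. *)
  exists z; apply (relax_fixed eps lam' tau ((3 + 6 * L) * c + c) be z); try assumption.
  intros n.
  assert (Bn : box (dl / 2) (M + 1) (R0 + 1) (zn n)).
  { destruct (Hind n) as [_ [_ [HC _]]].
    apply (close_box dl M R0 (c * (1 - be ^ n)) z0); try assumption; specialize (Hpow n); nra. }
  assert (HR := relax_close eps lam' tau L (c * be ^ n) (zn n) z Heps ltac:(lra) HL0
    (proj1 (Hind n)) Az (HL _ _ _ _ Hlam' Bn Bz) (Hclose n)).
  assert (HS := Hclose (S n)).
  assert (Hle : c * be ^ S n <= c * be ^ n).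
  { simpl; specialize (Hpow n).
    assert (0 <= c * be ^ n) by (apply Rmult_le_pos; lra); nra. }
  intros x; destruct (HR x) as [X1 [X2 [X3 X4]]]; destruct (HS x) as [Y1 [Y2 [Y3 Y4]]].
  change (zn (S n)) with (relax eps lam' tau (zn n)) in Y1, Y2, Y3, Y4.
  apply Rabs_le_between in X1, X2, X3, X4, Y1, Y2, Y3, Y4.
  repeat split; apply Rabs_le_between; lra.
Qed.

(** * A priori estimates *)

Lemma H2_nonneg (p : R) : 0 <= H2 p.
Proof.
  apply (der_nonneg_right H1 p); [|apply DH1].
  intros eta He; exists (p + eta / 2); split; [lra|].
  assert (T := H1_mono (p + eta / 2) p).
  apply (Rmult_le_reg_r (p + eta / 2 - p)); lra.
Qed.

(** Beyond [B] each term on the left is at most a quarter of m^{alpha + 1}; below [B] both are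
    bounded. The base 4 c + 1 in [B] is positive even for c = 0. *)
Lemma power_absorb (c : R) : 0 <= c -> exists K, 0 <= K /\ forall m, 0 < m ->
  Rpower m alpha + c * m <= / 2 * (Rpower m alpha * m) + K.
Proof.
  intros Hc.
  set (B := Rmax 4 (Rpower (4 * c + 1) (/ alpha))).
  assert (HB4 : 4 <= B) by apply Rmax_l.
  assert (HB5 : 4 * c <= Rpower B alpha).
  { assert (Hle : Rpower (4 * c + 1) (/ alpha) <= B) by apply Rmax_r.
    apply Rle_trans with (Rpower (Rpower (4 * c + 1) (/ alpha)) alpha).
    - rewrite Rpower_mult, Rinv_l, Rpower_1; lra.
    - apply Rle_Rpower_l; [lra | split; [apply exp_pos | exact Hle]]. }
  assert (HBp : 0 < Rpower B alpha) by apply exp_pos.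
  exists (Rpower B alpha + c * B); split.
  { assert (0 <= c * B) by (apply Rmult_le_pos; lra); lra. }
  intros m Hm; assert (Hmp : 0 < Rpower m alpha) by apply exp_pos.
  assert (0 <= c * B) by (apply Rmult_le_pos; lra).
  assert (0 <= Rpower m alpha * m) by (apply Rmult_le_pos; lra).
  destruct (Rle_lt_dec B m) as [HBm|HBm].
  - assert (Hmono : Rpower B alpha <= Rpower m alpha) by (apply Rle_Rpower_l; lra).
    assert (4 * Rpower m alpha <= Rpower m alpha * m) by nra.
    assert (4 * c * m <= Rpower m alpha * m) by (apply Rmult_le_compat_r; lra); lra.
  - assert (Hmono : Rpower m alpha <= Rpower B alpha) by (apply Rle_Rpower_l; lra).
    assert (c * m <= c * B) by (apply Rmult_le_compat_l; lra); lra.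
Qed.

Lemma power_le_one_plus (m : R) : 0 < m -> Rpower m alpha <= 1 + Rpower m alpha * m.
Proof.
  intros Hm; assert (Hmp : 0 < Rpower m alpha) by apply exp_pos.
  destruct (Rle_lt_dec 1 m) as [H1m|H1m]; [nra|].
  assert (Hle : Rpower m alpha <= Rpower 1 alpha) by (apply Rle_Rpower_l; lra).
  replace (Rpower 1 alpha) with 1 in Hle
    by (unfold Rpower; rewrite ln_1, Rmult_0_r, exp_0; reflexivity).
  assert (0 < Rpower m alpha * m) by (apply Rmult_lt_0_compat; lra); lra.
Qed.

(** The combination is differentiable because it is a Green potential; [sp] and [sr] separately are
    differentiated only in [sp_derive] and [sr_derive]. *)
Lemma sol_flux1 (eps lam : R) (z : state) (x : R) : sol eps lam z ->
  is_derive (fun y => sp z y - eps * sr z y) x (su z x - eps * sm z x - srcF eps lam z x).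
Proof.
  intros [A Em Er Eu Ep]; apply (der_ext (dgreen (srcF eps lam z))); [exact Er|].
  rewrite <- Em; apply dgreen_derive; [apply srcF_cont, A | apply srcF_periodic, A].
Qed.

Lemma sol_flux2 (eps lam : R) (z : state) (x : R) : sol eps lam z ->
  is_derive (fun y => sr z y + eps * sp z y + srcP lam z y) x (sm z x + eps * su z x - 1).
Proof.
  intros [A Em Er Eu Ep]; apply (der_ext (green (srcP lam z))); [exact Ep|].
  rewrite <- Eu; apply green_derive; [apply srcP_cont, A | apply srcP_periodic, A].
Qed.

Variable C0 : R.
Hypothesis HC0 : 0 <= C0.
Hypothesis Hlow : forall p, - C0 <= H p.

(* [p H'(p) - H(p)] is the Legendre transform of [H] at [H'(p)]; testing it at [1] and [-1]
   bounds [|H'(p)|]. *)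
Lemma H1_legendre (lam p : R) : 0 <= lam <= 1 ->
  lam * Rabs (H1 p) <= lam * (p * H1 p - H p) + (Rabs (H 1) + Rabs (H (-1))).
Proof.
  intros Hlam; assert (T1 := Htangent p 1); assert (T2 := Htangent p (-1)).
  assert (B1 := Rle_abs (H 1)); assert (B2 := Rle_abs (H (-1))).
  assert (B3 := Rabs_pos (H 1)); assert (B4 := Rabs_pos (H (-1))).
  assert (T3 : Rabs (H1 p) <= (p * H1 p - H p) + (Rabs (H 1) + Rabs (H (-1))))
    by (apply Rabs_le_between; lra).
  apply (Rmult_le_compat_l lam) in T3; [|lra]; nra.
Qed.

(** The first equation tested with m, minus the second tested with u ([X3]), loses all products of u
    and m. It balances m^{alpha + 1}, lam m (p H'(p) - H(p)) and eps times squared H^1 norms against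
    the mean of u and terms linear in m. The first equation tested with 1 ([X1]) replaces the mean
    of u and brings lam H(p) to the good side. *)
Lemma energy_bound : exists K, 0 <= K /\ forall eps lam z, 0 < eps <= 1 -> 0 <= lam <= 1 ->
  sol eps lam z ->
  mean (fun x => Rabs (srcF eps lam z x)) <= K /\ mean (fun x => Rabs (srcP lam z x)) <= K.
Proof.
  destruct (periodic1_bounded V PV CV) as [KV [HKV KV1]].
  set (c1 := Rabs (H 1) + Rabs (H (-1))).
  assert (Hc1 : 0 <= c1).
  { unfold c1; assert (T1 := Rabs_pos (H 1)); assert (T2 := Rabs_pos (H (-1))); lra. }
  set (W := KV + 2).
  destruct (power_absorb (c1 + W + 1)) as [K0 [HK0 K01]]; [unfold W; lra|].
  set (K := K0 + W + C0).
  assert (HK : 0 <= K) by (unfold K, W; lra).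
  exists (2 * K + (1 + W + C0)); split; [unfold W; lra|].
  intros eps lam z Heps Hlam HS.
  assert (A := sol_adm _ _ _ HS); destruct (sol_curve _ _ _ HS) as [Du Dm].
  assert (D1 := fun x => sol_flux1 eps lam z x HS).
  assert (D2 := fun x => sol_flux2 eps lam z x HS).
  assert (CF := srcF_cont eps lam z A); assert (PF := srcF_periodic eps lam z A).
  assert (CP := srcP_cont lam z A); assert (PP := srcP_periodic lam z A).
  assert (Ch := CH); assert (Ch1 := CH1).
  assert (CR := cont_Rpower (sm z) alpha (reg_cm z (adm_reg z A)) (adm_pos z A)).
  destruct A as [[Cu Cm Cp Cr Pu Pm Pp Pr] Hpos].
  set (X1 := fun x => su z x - eps * sm z x - srcF eps lam z x).
  set (X3 := fun x => X1 x * sm z x + (sp z x - eps * sr z x) * sr z x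
    - ((sm z x + eps * su z x - 1) * su z x
       + (sr z x + eps * sp z x + srcP lam z x) * sp z x)).
  assert (CX1 : continuity X1) by (unfold X1; cont).
  assert (CX3 : continuity X3) by (unfold X3; cont).
  assert (M1 : mean X1 = 0).
  { apply (mean_derivative (fun y => sp z y - eps * sr z y)); [|exact CX1|exact D1].
    intros x; rewrite Pp, Pr; reflexivity. }
  assert (M3 : mean X3 = 0).
  { apply (mean_derivative (fun y => (sp z y - eps * sr z y) * sm z y
      - (sr z y + eps * sp z y + srcP lam z y) * su z y)); [|exact CX3|].
    - intros x; rewrite Pp, Pr, Pm, Pu, PP; reflexivity.
    - intros x; apply (der_minus (fun y => (sp z y - eps * sr z y) * sm z y)
        (fun y => (sr z y + eps * sp z y + srcP lam z y) * su z y)).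
      + apply (der_mult (fun y => sp z y - eps * sr z y)); [apply D1 | apply Dm].
      + apply (der_mult (fun y => sr z y + eps * sp z y + srcP lam z y)); [apply D2 | apply Du]. }
  (* The shifts by [c1] and [C0] make all three summands nonnegative, so that the mean of [e] bounds
     each of them. *)
  set (e := fun x => sm z x * (lam * (sp z x * H1 (sp z x) - H (sp z x)) + c1)
    + / 2 * (Rpower (sm z x) alpha * sm z x) + (lam * H (sp z x) + C0)).
  assert (Ce : continuity e) by (unfold e; cont).
  assert (HV : forall x, Rabs (lam * V x + (1 - lam) * (1 + eps)) <= W).
  { intros x; specialize (KV1 x); apply Rabs_le_between in KV1; apply Rabs_le_between.
    unfold W; split; nra. }
  assert (Hlow' : forall x, 0 <= lam * H (sp z x) + C0).
  { intros x; specialize (Hlow (sp z x)).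
    assert (lam * - C0 <= lam * H (sp z x)) by (apply Rmult_le_compat_l; lra); nra. }
  assert (Me : mean e <= K).
  (* [X1] and [X3] have mean zero and may be added freely; pointwise, [power_absorb] then pays for
     the terms linear in m and for m^alpha. *)
  { apply Rle_trans with (mean (fun x => K + (X1 x + -1 * X3 x))).
    - apply mean_le; [exact Ce | cont |]; intros x.
      assert (HVx := HV x); apply Rabs_le_between in HVx.
      specialize (K01 (sm z x) (Hpos x)); specialize (Hpos x).
      unfold X3, X1, e, srcF, srcP.
      set (m := sm z x) in *; set (p := sp z x) in *;
      set (r := sr z x) in *; set (u := su z x) in *; set (a := Rpower m alpha) in *.
      set (v := lam * V x + (1 - lam) * (1 + eps)) in *.
      assert (Hq : 0 <= eps * (m ^ 2 + r ^ 2 + u ^ 2 + p ^ 2)).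
      { apply Rmult_le_pos; [lra|].
        assert (T1 := pow2_ge_0 m); assert (T2 := pow2_ge_0 r);
        assert (T3 := pow2_ge_0 u); assert (T4 := pow2_ge_0 p); lra. }
      assert (Hv : m * (v + eps) <= m * (W + 1)) by (apply Rmult_le_compat_l; lra).
      unfold K; unfold v in *; lra.
    - rewrite mean_plus, mean_plus, mean_scal, mean_const, M1, M3 by cont; lra. }
  assert (HE : forall x, 0 <= lam * (sp z x * H1 (sp z x) - H (sp z x)) + c1).
  { intros x; assert (T := H1_legendre lam (sp z x) Hlam); fold c1 in T.
    assert (0 <= lam * Rabs (H1 (sp z x))) by (apply Rmult_le_pos; [lra | apply Rabs_pos]); lra. }
  assert (HmE : forall x, 0 <= sm z x * (lam * (sp z x * H1 (sp z x) - H (sp z x)) + c1)).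
  { intros x; apply Rmult_le_pos; [left; apply Hpos | apply HE]. }
  assert (Hma : forall x, 0 <= / 2 * (Rpower (sm z x) alpha * sm z x)).
  { intros x; apply Rmult_le_pos; [lra|]; apply Rmult_le_pos; left; [apply exp_pos | apply Hpos]. }
  split.
  - apply Rle_trans with (mean (fun x => 2 * e x + (1 + W + C0))).
    + apply mean_le; [cont|cont|]; intros x.
      specialize (HmE x); specialize (Hlow' x); specialize (Hma x).
      assert (HVx := HV x); apply Rabs_le_between in HVx.
      assert (Hp1 := power_le_one_plus (sm z x) (Hpos x)).
      assert (Hap : 0 < Rpower (sm z x) alpha) by apply exp_pos.
      unfold e; apply Rabs_le_between; unfold srcF; split; lra.
    + rewrite mean_plus, mean_scal, mean_const by cont; lra.
  - apply Rle_trans with (mean e); [|unfold W; lra].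
    apply mean_le; [cont|exact Ce|]; intros x.
    specialize (Hlow' x); specialize (Hma x).
    assert (T := H1_legendre lam (sp z x) Hlam); fold c1 in T.
    unfold srcP; rewrite !Rabs_mult, (Rabs_pos_eq lam), (Rabs_pos_eq (sm z x))
      by (try lra; left; apply Hpos).
    apply (Rmult_le_compat_l (sm z x)) in T; [|left; apply Hpos].
    unfold e; lra.
Qed.

Lemma sup_bound : exists M R0, 1 <= M /\ 0 <= R0 /\
  forall eps lam z, 0 < eps <= 1 -> 0 <= lam <= 1 -> sol eps lam z ->
  forall x, Rabs (su z x) <= M /\ sm z x <= M /\ Rabs (sp z x) <= R0 /\ Rabs (sr z x) <= R0.
Proof.
  destruct energy_bound as [K [HK HKK]].
  set (M := 4 * K + 1).
  set (R1 := 4 * K + M * Rabs (H1 0)).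
  assert (HR1 : 0 <= R1).
  { assert (0 <= M * Rabs (H1 0)) by (apply Rmult_le_pos; [unfold M; lra | apply Rabs_pos]).
    unfold R1; lra. }
  destruct (bounded_on H1 (- R1) R1) as [KH [HKH KH1]]; [intros; apply CH1|].
  assert (HKM : 0 <= KH * M) by (apply Rmult_le_pos; [assumption | unfold M; lra]).
  exists M, (2 * K + R1 + KH * M); split; [unfold M; lra|]; split; [lra|].
  intros eps lam z Heps Hlam HS x.
  destruct (HKK eps lam z Heps Hlam HS) as [BF BP].
  assert (A := sol_adm _ _ _ HS).
  assert (CF := srcF_cont eps lam z A); assert (PF := srcF_periodic eps lam z A).
  assert (CP := srcP_cont lam z A); assert (PP := srcP_periodic lam z A).
  assert (B1 := green_bound _ CF PF x); assert (B2 := dgreen_bound _ CF PF x).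
  assert (B3 := green_bound _ CP PP x); assert (B4 := dgreen_bound _ CP PP x).
  rewrite (sol_m _ _ _ HS) in B1; rewrite (sol_r _ _ _ HS) in B2.
  rewrite (sol_p _ _ _ HS) in B3; rewrite (sol_u _ _ _ HS) in B4.
  assert (Hpos := adm_pos z A x).
  change (srcP lam z x) with (lam * H1 (sp z x) * sm z x) in B3.
  set (m := sm z x) in *; set (p := sp z x) in *; set (r := sr z x) in *; set (u := su z x) in *.
  assert (Heu : forall t, Rabs t <= 2 * K + 1 -> Rabs (eps * t) <= 2 * K + 1).
  { intros t Ht; rewrite Rabs_mult, (Rabs_pos_eq eps) by lra; assert (T := Rabs_pos t); nra. }
  (* The Green bounds control [w] and n - 1; solving for u and m divides by 1 + eps^2 >= 1, which
     does no harm. *)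
  set (w := u - eps * m) in *; set (n := m + eps * u) in *.
  assert (Hw : Rabs w <= 2 * K) by lra.
  assert (Hn : Rabs (n - 1) <= 2 * K) by lra.
  assert (Hn1 : Rabs n <= 2 * K + 1).
  { apply Rabs_le_between in Hn; apply Rabs_le_between; lra. }
  assert (Hen := Heu n Hn1).
  assert (Hew : Rabs (eps * w) <= 2 * K).
  { rewrite Rabs_mult, (Rabs_pos_eq eps) by lra; assert (T := Rabs_pos w); nra. }
  assert (Hdiv : forall t b, Rabs ((1 + eps ^ 2) * t) <= b -> Rabs t <= b).
  { intros t b Ht; rewrite Rabs_mult, Rabs_pos_eq in Ht by nra.
    assert (T := Rabs_pos t); nra. }
  assert (Hu : Rabs u <= M).
  { apply Hdiv; replace ((1 + eps ^ 2) * u) with (w + eps * n) by (unfold w, n; ring).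
    apply Rabs_le_between in Hw, Hen; apply Rabs_le_between; unfold M; lra. }
  assert (Hm : m <= M).
  { rewrite <- (Rabs_pos_eq m) by lra.
    apply Hdiv; replace ((1 + eps ^ 2) * m) with (n - eps * w) by (unfold w, n; ring).
    apply Rabs_le_between in Hn1, Hew; apply Rabs_le_between; unfold M; lra. }
  set (q1 := p - eps * r) in *; set (q2 := r + eps * p + lam * H1 p * m) in *.
  assert (Hq1 : Rabs q1 <= 2 * K) by lra.
  assert (Hq2 : Rabs q2 <= 2 * K) by lra.
  (* After elimination of [r] and subtraction of [H1 0], multiplying by [p] makes the monotone term
     nonnegative, and p^2 <= p * rhs follows. *)
  assert (Hp : Rabs p <= R1).
  { set (g := eps * lam * m).
    assert (Hg : 0 <= g <= M).
    { assert (0 <= eps * lam <= 1) by nra; unfold g; split; [apply Rmult_le_pos; lra | nra]. }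
    set (rhs := q1 + eps * q2 - g * H1 0).
    assert (E : (1 + eps ^ 2) * p + g * (H1 p - H1 0) = rhs)
      by (unfold rhs, q1, q2, g; ring).
    assert (Hrhs : Rabs rhs <= R1).
    { unfold rhs; assert (T1 : Rabs (eps * q2) <= 2 * K).
      { rewrite Rabs_mult, (Rabs_pos_eq eps) by lra; assert (T := Rabs_pos q2); nra. }
      assert (T2 : Rabs (g * H1 0) <= M * Rabs (H1 0)).
      { rewrite Rabs_mult, (Rabs_pos_eq g) by lra; apply Rmult_le_compat_r; [apply Rabs_pos | lra]. }
      apply Rabs_le_between in Hq1, T1, T2; apply Rabs_le_between; unfold R1; lra. }
    assert (T := H1_mono p 0); rewrite Rminus_0_r in T.
    assert (Hpp : p * p <= p * rhs).
    { rewrite <- E.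
      assert (0 <= g * ((H1 p - H1 0) * p)) by (apply Rmult_le_pos; lra).
      assert (0 <= eps ^ 2 * (p * p)) by (apply Rmult_le_pos; nra); lra. }
    apply Rle_trans with (Rabs rhs); [|exact Hrhs].
    assert (Hab : Rabs p * Rabs p <= Rabs p * Rabs rhs).
    { rewrite <- !Rabs_mult; rewrite (Rabs_pos_eq (p * p)) by nra.
      eapply Rle_trans; [exact Hpp | apply Rle_abs]. }
    assert (Tp := Rabs_pos p); assert (Tr := Rabs_pos rhs); nra. }
  split; [exact Hu|]; split; [exact Hm|]; split; [lra|].
  replace r with (q2 - eps * p - lam * H1 p * m) by (unfold q2; ring).
  assert (Hep : Rabs (eps * p) <= R1).
  { rewrite Rabs_mult, (Rabs_pos_eq eps) by lra; assert (T := Rabs_pos p); nra. }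
  assert (HlH : Rabs (lam * H1 p * m) <= KH * M).
  { assert (Hpb := Hp); apply Rabs_le_between in Hpb; specialize (KH1 p Hpb).
    rewrite !Rabs_mult, (Rabs_pos_eq lam), (Rabs_pos_eq m) by lra.
    assert (T := Rabs_pos (H1 p)); apply Rmult_le_compat; [apply Rmult_le_pos| | |]; nra. }
  apply Rabs_le_between in Hq2, Hep, HlH; apply Rabs_le_between; lra.
Qed.

(** [sp1] and [sr1] express u_xx and m_xx through lower-order quantities. The denominator comes from
    differentiating (1 + eps^2) p + eps lam m H'(p); it is at least 1, so the bound on u_xx is
    uniform in [eps]. The same formulas drive the regularity argument in [theorem1]. *)
Definition sp1 (eps lam : R) (z : state) (x : R) : R :=
  ((su z x - eps * sm z x - srcF eps lam z x) + eps * (sm z x + eps * su z x - 1)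
   - eps * lam * sr z x * H1 (sp z x))
  / (1 + eps ^ 2 + eps * lam * sm z x * H2 (sp z x)).

Definition sr1 (eps lam : R) (z : state) (x : R) : R :=
  sm z x + eps * su z x - 1 - eps * sp1 eps lam z x
  - lam * (H2 (sp z x) * sp1 eps lam z x * sm z x + H1 (sp z x) * sr z x).

Lemma sp1_den (eps lam : R) (z : state) (x : R) : 0 < eps -> 0 <= lam -> adm z ->
  1 <= 1 + eps ^ 2 + eps * lam * sm z x * H2 (sp z x).
Proof.
  intros He Hl A; assert (T := pow2_ge_0 eps); assert (Hpos := adm_pos z A x).
  assert (0 <= eps * lam * sm z x * H2 (sp z x)); [|lra].
  repeat apply Rmult_le_pos; try lra; apply H2_nonneg.
Qed.

Lemma sp_derive (eps lam : R) (z : state) (x : R) : 0 < eps -> 0 <= lam -> sol eps lam z ->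
  is_derive (sp z) x (sp1 eps lam z x).
Proof.
  intros He Hl HS; assert (A := sol_adm _ _ _ HS).
  assert (D1 := fun x => sol_flux1 eps lam z x HS).
  assert (D2 := fun x => sol_flux2 eps lam z x HS).
  apply (implicit_derive H1 H2 (sp z) (sm z)
    (fun y => (sp z y - eps * sr z y) + eps * (sr z y + eps * sp z y + srcP lam z y))).
  - assert (T := pow2_ge_0 eps); lra.
  - apply Rmult_le_pos; lra.
  - exact H1_mono.
  - exact DH1.
  - exact H2_nonneg.
  - intros y; left; apply (adm_pos z A).
  - intros y; unfold srcP; ring.
  - apply (reg_cp z (adm_reg z A)).
  - apply (sol_curve _ _ _ HS).
  - eapply der_eq.
    + apply (der_plus (fun y => sp z y - eps * sr z y)); [apply D1|].
      apply (der_mult (fun _ => eps)); [apply der_const | apply D2].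
    + ring.
Qed.

Lemma sr_derive (eps lam : R) (z : state) (x : R) : 0 < eps -> 0 <= lam -> sol eps lam z ->
  is_derive (sr z) x (sr1 eps lam z x).
Proof.
  intros He Hl HS.
  assert (D2 := fun x => sol_flux2 eps lam z x HS).
  assert (Dp := fun x => sp_derive eps lam z x He Hl HS).
  destruct (sol_curve _ _ _ HS) as [Du Dm].
  apply (der_ext (fun y => (sr z y + eps * sp z y + srcP lam z y)
    - (eps * sp z y + lam * (H1 (sp z y) * sm z y)))).
  { intros y; unfold srcP; ring. }
  eapply der_eq.
  - apply (der_minus (fun y => sr z y + eps * sp z y + srcP lam z y)); [apply D2|].
    repeat der_step.
  - unfold sr1; ring.
Qed.

Lemma apriori : exists eps0 dl M R0, 0 < eps0 /\ 0 < dl /\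
  forall eps lam z, 0 < eps <= 1 -> eps < eps0 -> 0 <= lam <= 1 -> sol eps lam z ->
  box dl M R0 z.
Proof.
  destruct sup_bound as [M [R0 [HM [HR HB]]]].
  destruct (bounded_on H (- R0) R0) as [KH [HKH KH0]]; [intros; apply CH|].
  destruct (bounded_on H1 (- R0) R0) as [KH' [HKH' KH1]]; [intros; apply CH1|].
  destruct (bounded_on H2 (- R0) R0) as [KH'' [HKH'' KH2]]; [intros; apply CH2|].
  destruct (periodic1_bounded V PV CV) as [KV [HKV KV1]].
  set (BF := Rpower M alpha + (KV + KH) + 2).
  assert (HMp : 0 < Rpower M alpha) by apply exp_pos.
  assert (HBF : 0 <= BF) by (unfold BF; lra).
  set (B1 := 4 * M + BF + 1 + R0 * KH').
  assert (HRK : 0 <= R0 * KH') by (apply Rmult_le_pos; assumption).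
  assert (HB1 : 0 <= B1) by (unfold B1; lra).
  assert (HKB : 0 <= KH'' * B1) by (apply Rmult_le_pos; assumption).
  (* The first value gives eps (u - u_xx) <= 1/2; the second is the bound on m resulting from m (1 +
     KH'' B1) >= 1/2 at a minimum. *)
  exists (/ (2 * (M + B1))), (/ (2 * (1 + KH'' * B1))), M, R0.
  split; [apply Rinv_0_lt_compat; lra|]; split; [apply Rinv_0_lt_compat; lra|].
  intros eps lam z Heps Heps0 Hlam HS.
  specialize (HB eps lam z Heps Hlam HS).
  assert (A := sol_adm _ _ _ HS).
  assert (Hpos := adm_pos z A).
  assert (Hsp1 : forall x, Rabs (sp1 eps lam z x) <= B1).
  { intros x; destruct (HB x) as [Hu [Hm [Hp Hr]]].
    assert (Hpb := Hp); apply Rabs_le_between in Hpb.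
    specialize (KH0 _ Hpb); specialize (KH1 _ Hpb); specialize (KV1 x); specialize (Hpos x).
    assert (HF : Rabs (srcF eps lam z x) <= BF).
    { assert (Hpm : Rpower (sm z x) alpha <= Rpower M alpha) by (apply Rle_Rpower_l; lra).
      assert (Hpp : 0 < Rpower (sm z x) alpha) by apply exp_pos.
      assert (HVH : Rabs (lam * (V x + H (sp z x))) <= KV + KH).
      { rewrite Rabs_mult, (Rabs_pos_eq lam) by lra.
        assert (T := Rabs_triang (V x) (H (sp z x))).
        assert (T' := Rabs_pos (V x + H (sp z x))); nra. }
      apply Rabs_le_between in HVH; apply Rabs_le_between; unfold srcF, BF.
      assert (0 <= (1 - lam) * (1 + eps) <= 2) by nra; lra. }
    unfold sp1, Rdiv; rewrite Rabs_mult.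
    assert (Hden := sp1_den eps lam z x (proj1 Heps) (proj1 Hlam) A).
    rewrite (Rabs_pos_eq (/ _)) by (left; apply Rinv_0_lt_compat; lra).
    apply Rle_trans with (B1 * 1); [|lra].
    apply Rmult_le_compat; [apply Rabs_pos | left; apply Rinv_0_lt_compat; lra | |].
    2:{ rewrite <- Rinv_1; apply Rinv_le_contravar; lra. }
    assert (Heu : Rabs (eps * su z x) <= M).
    { rewrite Rabs_mult, (Rabs_pos_eq eps) by lra; assert (T := Rabs_pos (su z x)); nra. }
    assert (Heeu : Rabs (eps * (sm z x + eps * su z x - 1)) <= 2 * M + 1).
    { rewrite Rabs_mult, (Rabs_pos_eq eps) by lra.
      apply Rle_trans with (1 * (2 * M + 1)); [|lra].
      apply Rmult_le_compat; [lra | apply Rabs_pos | lra |].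
      apply Rabs_le_between in Heu; apply Rabs_le_between; lra. }
    assert (HrH : Rabs (eps * lam * sr z x * H1 (sp z x)) <= R0 * KH').
    { rewrite !Rabs_mult, (Rabs_pos_eq eps), (Rabs_pos_eq lam) by lra.
      assert (0 <= eps * lam <= 1) by nra.
      assert (T1 := Rabs_pos (sr z x)).
      apply Rmult_le_compat; [apply Rmult_le_pos; lra | apply Rabs_pos | nra | exact KH1]. }
    assert (0 <= eps * sm z x <= M) by nra.
    apply Rabs_le_between in Hu, HF, Heeu, HrH; apply Rabs_le_between; unfold B1; lra. }
  destruct (periodic1_min (sm z) (reg_pm z (adm_reg z A)) (reg_cm z (adm_reg z A))) as [x0 Hx0].
  destruct (sol_curve _ _ _ HS) as [Du Dm].
  assert (Hr0 : sr z x0 = 0) by (apply (der_min (sm z) x0); [exact Hx0 | apply Dm]).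
  assert (Hr1 : 0 <= sr1 eps lam z x0).
  { apply (der2_min (sm z) (sr z) x0); [exact Hx0 | exact Dm |].
    apply sr_derive; [lra | lra | exact HS]. }
  (* As m_x = 0, the term H'(u_x) m_x disappears, and m_xx >= 0 becomes m (1 - lam H''(u_x) u_xx) >=
     1 - eps (u - u_xx). *)
  unfold sr1 in Hr1; rewrite Hr0 in Hr1.
  assert (Hmin : / (2 * (1 + KH'' * B1)) <= sm z x0).
  { specialize (Hsp1 x0); destruct (HB x0) as [Hu [Hm [Hp _]]].
    apply Rabs_le_between in Hp; specialize (KH2 _ Hp); specialize (Hpos x0).
    set (d := sp1 eps lam z x0) in *; set (m := sm z x0) in *.
    assert (Heud : eps * (M + B1) <= / 2).
    { apply Rlt_le in Heps0; apply (Rmult_le_compat_r (M + B1)) in Heps0; [|lra].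
      replace (/ (2 * (M + B1)) * (M + B1)) with (/ 2) in Heps0 by (field; lra); lra. }
    assert (Heud' : eps * (su z x0 - d) <= eps * (M + B1)).
    { apply Rmult_le_compat_l; [lra|]; apply Rabs_le_between in Hu, Hsp1; lra. }
    assert (HHd : Rabs (lam * (H2 (sp z x0) * d)) <= KH'' * B1).
    { rewrite !Rabs_mult, (Rabs_pos_eq lam) by lra.
      assert (T1 := Rabs_pos (H2 (sp z x0))); assert (T2 := Rabs_pos d).
      assert (Rabs (H2 (sp z x0)) * Rabs d <= KH'' * B1) by (apply Rmult_le_compat; assumption).
      assert (0 <= Rabs (H2 (sp z x0)) * Rabs d) by (apply Rmult_le_pos; assumption); nra. }
    apply Rabs_le_between in HHd.
    assert (Hfin : / 2 <= m * (1 + KH'' * B1)).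
    { assert (m * - (lam * (H2 (sp z x0) * d)) <= m * (KH'' * B1))
        by (apply Rmult_le_compat_l; lra).
      lra. }
    apply (Rmult_le_reg_r (1 + KH'' * B1)); [lra|].
    replace (/ (2 * (1 + KH'' * B1)) * (1 + KH'' * B1)) with (/ 2) by (field; lra); lra. }
  intros x; destruct (HB x) as [_ [Hm [Hp _]]]; specialize (Hx0 x).
  split; [split; lra | exact Hp].
Qed.

(** * Continuation from [lam = 0] to [lam = 1] *)

Lemma sol_zero (eps : R) : sol eps 0 (State (fun _ => 0) (fun _ => 1) (fun _ => 0) (fun _ => 0)).
Proof.
  assert (EF : forall x, srcF eps 0 (State (fun _ => 0) (fun _ => 1) (fun _ => 0) (fun _ => 0)) x
    = - eps).
  { intros x; unfold srcF; simpl; unfold Rpower; rewrite ln_1, Rmult_0_r, exp_0; ring. }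
  assert (EP : forall x, srcP 0 (State (fun _ => 0) (fun _ => 1) (fun _ => 0) (fun _ => 0)) x = 0).
  { intros x; unfold srcP; ring. }
  constructor.
  - constructor; [constructor; simpl; try apply cont_const; intros x; reflexivity | simpl; intros; lra].
  - intros x; rewrite (green_const _ (- eps)) by exact EF; simpl; ring.
  - intros x; rewrite (dgreen_const _ (- eps)) by exact EF; simpl; ring.
  - intros x; rewrite (dgreen_const _ 0) by exact EP; simpl; ring.
  - intros x; rewrite (green_const _ 0), EP by exact EP; simpl; ring.
Qed.

(** [homotopy_step] returns a solution without a box; [apriori] places it in the original one, so
    the same step length [eta] serves again and finitely many steps suffice. *)
Lemma homotopy_end : exists eps0, 0 < eps0 /\ forall eps, 0 < eps <= 1 -> eps < eps0 ->
  exists z, sol eps 1 z.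
Proof.
  destruct apriori as [eps0 [dl [M [R0 [He0 [Hdl HA]]]]]].
  exists eps0; split; [exact He0|]; intros eps Heps Heps0.
  destruct (homotopy_step eps dl M R0 Heps Hdl) as [eta [Heta Hstep]].
  destruct (archimed_cor1 eta Heta) as [N [HN HN0]].
  assert (HNp : 0 < INR N) by (apply lt_0_INR, HN0).
  assert (Hind : forall k, (k <= N)%nat -> exists z, sol eps (INR k / INR N) z).
  { induction k as [|k IH]; intros Hk.
    - replace (INR 0 / INR N) with 0 by (simpl; field; lra); eexists; apply sol_zero.
    - destruct IH as [z HS]; [lia|].
      assert (Hfrac : forall j, (j <= N)%nat -> 0 <= INR j / INR N <= 1).
      { intros j Hj; apply le_INR in Hj; assert (T := pos_INR j); split.
        - apply Rmult_le_pos; [exact T | left; apply Rinv_0_lt_compat; lra].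
        - apply (Rmult_le_reg_r (INR N)); [lra|].
          replace (INR j / INR N * INR N) with (INR j) by (field; lra); lra. }
      apply (Hstep (INR k / INR N) (INR (S k) / INR N) z).
      + apply Hfrac, Hk.
      + replace (INR (S k) / INR N - INR k / INR N) with (/ INR N)
          by (rewrite S_INR; field; lra).
        rewrite Rabs_pos_eq; [lra | left; apply Rinv_0_lt_compat; lra].
      + exact HS.
      + apply (HA eps (INR k / INR N)); try assumption; apply Hfrac; lia. }
  destruct (Hind N (le_n N)) as [z HS]; exists z.
  replace (INR N / INR N) with 1 in HS by (field; lra); exact HS.
Qed.

End Homotopy.

(** * Regularity of solutions *)

Definition smooth1 (f : R -> R) : Prop :=
  exists f', (forall x, is_derive f x (f' x)) /\ continuity f'.

Lemma smooth1_const (c : R) : smooth1 (fun _ => c).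
Proof. exists (fun _ => 0); split; [intros x; apply der_const | cont]. Qed.

Lemma smooth1_plus (f g : R -> R) : smooth1 f -> smooth1 g -> smooth1 (fun x => f x + g x).
Proof.
  intros [f' [Df Cf]] [g' [Dg Cg]]; exists (fun x => f' x + g' x); split; [|cont].
  intros x; der; reflexivity.
Qed.

Lemma smooth1_minus (f g : R -> R) : smooth1 f -> smooth1 g -> smooth1 (fun x => f x - g x).
Proof.
  intros [f' [Df Cf]] [g' [Dg Cg]]; exists (fun x => f' x - g' x); split; [|cont].
  intros x; der; reflexivity.
Qed.

Lemma smooth1_mult (f g : R -> R) : smooth1 f -> smooth1 g -> smooth1 (fun x => f x * g x).
Proof.
  intros [f' [Df Cf]] [g' [Dg Cg]].
  assert (C1 := der_cont f f' Df); assert (C2 := der_cont g g' Dg).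
  exists (fun x => f' x * g x + f x * g' x); split; [|cont].
  intros x; der; reflexivity.
Qed.

Lemma smooth1_comp (f g : R -> R) : smooth1 f -> smooth1 g -> smooth1 (fun x => f (g x)).
Proof.
  intros [f' [Df Cf]] [g' [Dg Cg]]; assert (C2 := der_cont g g' Dg).
  exists (fun x => f' (g x) * g' x); split; [|cont].
  intros x; der; reflexivity.
Qed.

Lemma smooth1_inv (f : R -> R) : smooth1 f -> (forall x, f x <> 0) -> smooth1 (fun x => / f x).
Proof.
  intros [f' [Df Cf]] Hf; assert (C1 := der_cont f f' Df).
  exists (fun x => - f' x / f x ^ 2); split.
  - intros x; apply is_derive_inv; [apply Df | apply Hf].
  - unfold Rdiv; cont; apply (cont_inv (fun x => f x ^ 2)); [cont|].
    intros x; apply pow_nonzero, Hf.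
Qed.

Lemma smooth1_Rpower (f : R -> R) (a : R) : smooth1 f -> (forall x, 0 < f x) ->
  smooth1 (fun x => Rpower (f x) a).
Proof.
  intros [f' [Df Cf]] Hf; assert (C1 := der_cont f f' Df).
  assert (C2 := cont_Rpower f (a - 1) C1 Hf).
  exists (fun x => a * Rpower (f x) (a - 1) * f' x); split; [|cont].
  intros x; apply der_Rpower; [apply Hf | apply Df].
Qed.

Ltac smooth_step :=
  match goal with
  | h : smooth1 ?f |- smooth1 ?f => exact h
  | h : smooth1 ?f |- smooth1 (fun x => ?f x) => exact h
  | |- smooth1 (fun _ => ?c) => apply (smooth1_const c)
  | |- smooth1 (fun x => @?f x + @?g x) => apply (smooth1_plus f g)
  | |- smooth1 (fun x => @?f x - @?g x) => apply (smooth1_minus f g)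
  | |- smooth1 (fun x => @?f x * @?g x) => apply (smooth1_mult f g)
  | |- smooth1 (fun x => @?f x / @?g x) => apply (smooth1_mult f (fun x => / g x))
  | h : smooth1 ?k |- smooth1 (fun x => ?k (@?f x)) => apply (smooth1_comp k f)
  end.
Ltac smooth := repeat smooth_step.

(** For |x - y| <= 1 the Lipschitz bound suffices, as d <= sqrt d; for larger distances the
    oscillation bound 2 K0 does. *)
Lemma smooth1_holder (f : R -> R) : periodic1 f -> smooth1 f -> holder_half f.
Proof.
  intros Hp [f' [Df Cf]].
  destruct (periodic1_bounded f Hp (der_cont f f' Df)) as [K0 [HK0 K01]].
  destruct (periodic1_bounded f' (periodic1_der f f' Hp Df) Cf) as [K1 [HK1 K11]].
  exists (K1 + 2 * K0); split; [lra|]; intros x y.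
  assert (Hl : Rabs (f x - f y) <= K1 * Rabs (x - y)).
  { destruct (MVT_gen f y x f') as [c [_ Hc]].
    - intros c _; apply Df.
    - intros c _; apply (der_cont f f' Df).
    - rewrite Hc, Rabs_mult; apply Rmult_le_compat_r; [apply Rabs_pos | apply K11]. }
  set (d := Rabs (x - y)) in *.
  assert (Hd : 0 <= d) by apply Rabs_pos.
  assert (Hs := sqrt_pos d); assert (Hss := sqrt_sqrt d Hd).
  destruct (Rle_lt_dec d 1) as [Hd1|Hd1].
  - assert (Hsd : d <= sqrt d).
    { assert (sqrt d <= 1) by (rewrite <- sqrt_1; apply sqrt_le_1_alt, Hd1); nra. }
    assert (K1 * d <= K1 * sqrt d) by (apply Rmult_le_compat_l; lra).
    assert (0 <= 2 * K0 * sqrt d) by (apply Rmult_le_pos; lra); lra.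
  - assert (Hsd : 1 <= sqrt d) by (rewrite <- sqrt_1; apply sqrt_le_1_alt; lra).
    assert (B1 := K01 x); assert (B2 := K01 y); apply Rabs_le_between in B1, B2.
    assert (Rabs (f x - f y) <= 2 * K0) by (apply Rabs_le_between; lra).
    assert (2 * K0 * 1 <= 2 * K0 * sqrt d) by (apply Rmult_le_compat_l; lra).
    assert (0 <= K1 * sqrt d) by (apply Rmult_le_pos; lra); lra.
Qed.

(** The gap [f] between chord and graph vanishes at t = 0 and is nonnegative on [0, 1], so its
    derivative at 0, which is the gap between [H q] and the tangent, is nonnegative. *)
Lemma convex_tangent (H H1 : R -> R) : convex H -> (forall p, is_derive H p (H1 p)) ->
  forall p q, H p + H1 p * (q - p) <= H q.
Proof.
  intros Hc DH p q.
  set (f := fun t => H p + t * (H q - H p) - H (p + t * (q - p))).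
  assert (Hd : is_derive f 0 ((H q - H p) - H1 p * (q - p))).
  { unfold f; der; replace (p + 0 * (q - p)) with p by ring; ring. }
  assert (Hf0 : f 0 = 0) by (unfold f; rewrite !Rmult_0_l, !Rplus_0_r; ring).
  apply der_nonneg_right in Hd; [lra|].
  intros eta He; set (t := Rmin (eta / 2) 1).
  assert (Ht : 0 < t) by (apply Rmin_glb_lt; lra).
  assert (Ht1 : t <= eta / 2) by apply Rmin_l; assert (Ht2 : t <= 1) by apply Rmin_r.
  exists t; split; [lra|]; rewrite Hf0; unfold f.
  assert (T := Hc q p t ltac:(lra)).
  replace (t * q + (1 - t) * p) with (p + t * (q - p)) in T by ring; lra.
Qed.

Lemma powabs_nonneg (p g : R) : 0 <= powabs p g.
Proof. unfold powabs; destruct (Req_EM_T p 0); [lra | left; apply exp_pos]. Qed.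

Theorem theorem1
  (H H1 H2 H3 H4 V V1 V2 : R -> R)
  (alpha gamma C1 C2 C3 Ct1 Ct2 Ct3 Cbar : R)
  (* (A5), which includes H in C^2; H1 = H' *)
  (hH : C4R H H1 H2 H3 H4)
  (* (A3) V in C^2(T) (in particular continuous and 1-periodic) *)
  (hV : C2T V V1 V2)
  (halpha : 0 < alpha)
  (* (A1) *)
  (hC1 : 0 < C1) (hC2 : 0 < C2) (hC3 : 0 < C3) (hgamma : 1 < gamma)
  (hA1 : forall p, - C1 + C2 * powabs p gamma <= H p <= C1 + C3 * powabs p gamma)
  (* (A2) *)
  (hCt1 : 0 < Ct1) (hCt2 : 0 < Ct2) (hCt3 : 0 < Ct3)
  (hA2 : forall p, - Ct1 + Ct2 * powabs p gamma <= p * H1 p - H p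
                   <= Ct1 + Ct3 * powabs p gamma)
  (* (A4) *)
  (hA4 : convex H)
  (* (A6) *)
  (hA6 : gamma < 2)
  (* (A7) *)
  (hCbar : 0 < Cbar)
  (hA7 : forall p, Rabs (H1 p) <= Cbar * (1 + powabs p (gamma - 1))) :
  exists eps0, 0 < eps0 /\
    forall eps, 0 < eps < eps0 -> eps <= 1 ->
      exists u u1 u2 m m1 m2 : R -> R,
        Problem1 H H1 V alpha eps u u1 u2 m m1 m2 /\
        C2halfT u u1 u2 /\ C2halfT m m1 m2 /\ (forall x, 0 < m x).
Proof.
  destruct hH as [dH [dH1 [dH2 [dH3 cH4]]]]; destruct hV as [PV [dV [dV1 cV2]]].
  assert (DH : forall p, is_derive H p (H1 p)) by (intros p; apply is_derive_Reals, dH).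
  assert (DH1 : forall p, is_derive H1 p (H2 p)) by (intros p; apply is_derive_Reals, dH1).
  assert (DH2 : forall p, is_derive H2 p (H3 p)) by (intros p; apply is_derive_Reals, dH2).
  assert (DH3 : forall p, is_derive H3 p (H4 p)) by (intros p; apply is_derive_Reals, dH3).
  assert (DV : forall x, is_derive V x (V1 x)) by (intros x; apply is_derive_Reals, dV).
  assert (DV1 : forall x, is_derive V1 x (V2 x)) by (intros x; apply is_derive_Reals, dV1).
  assert (CH2 := der_cont H2 H3 DH2); assert (CH3 := der_cont H3 H4 DH3).
  assert (CH1 := der_cont H1 H2 DH1).
  assert (CV := der_cont V V1 DV); assert (CV1 := der_cont V1 V2 DV1).
  assert (Ht := convex_tangent H H1 hA4 DH).
  assert (Hlow : forall p, - C1 <= H p).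
  { intros p; assert (T := proj1 (hA1 p)).
    assert (0 <= C2 * powabs p gamma) by (apply Rmult_le_pos; [lra | apply powabs_nonneg]); lra. }
  destruct (homotopy_end H H1 H2 V alpha halpha DH DH1 CH2 CV PV Ht C1 ltac:(lra) Hlow)
    as [eps0 [He0 Hsol]].
  exists eps0; split; [exact He0|]; intros eps Heps Heps1.
  destruct (Hsol eps ltac:(lra) ltac:(lra)) as [z HS].
  set (u2 := sp1 H H1 H2 V alpha eps 1 z); set (m2 := sr1 H H1 H2 V alpha eps 1 z).
  assert (Dp : forall x, is_derive (sp z) x (u2 x)).
  { intros x; apply sp_derive; try assumption; lra. }
  assert (Dr : forall x, is_derive (sr z) x (m2 x)).
  { intros x; apply sr_derive; try assumption; lra. }
  assert (Dflux1 := fun x => sol_flux1 H H1 V alpha DH CV PV eps 1 z x HS).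
  destruct (sol_curve H H1 H2 V alpha DH DH1 CV PV eps 1 z HS) as [Du Dm].
  assert (A := sol_adm _ _ _ _ _ _ _ HS); assert (Hpos := adm_pos z A).
  destruct (adm_reg z A) as [Cu Cm Cp Cr Pu Pm Pp Pr].
  assert (Su : smooth1 (su z)) by (exists (sp z); split; assumption).
  assert (Sm : smooth1 (sm z)) by (exists (sr z); split; assumption).
  assert (SV : smooth1 V) by (exists V1; split; assumption).
  assert (SH : smooth1 H) by (exists H1; split; assumption).
  assert (SH1 : smooth1 H1) by (exists H2; split; assumption).
  assert (SH2 : smooth1 H2) by (exists H3; split; assumption).
  assert (Cu2 : continuity u2).
  { unfold u2, sp1; assert (CF := srcF_cont H H1 V alpha DH CV eps 1 z A).
    cont; apply (cont_inv (fun x => 1 + eps ^ 2 + eps * 1 * sm z x * H2 (sp z x))); [cont|].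
    intros x; assert (T := sp1_den H H1 H2 DH1 Ht eps 1 z x (proj1 Heps) ltac:(lra) A); lra. }
  assert (Sp : smooth1 (sp z)) by (exists u2; split; assumption).
  assert (Cm2 : continuity m2) by (unfold m2, sr1; fold u2; cont).
  assert (Sr : smooth1 (sr z)) by (exists m2; split; assumption).
  assert (SR := smooth1_Rpower (sm z) alpha Sm Hpos).
  (* Bootstrap: [u2] is a formula in functions now known to be C^1, hence C^1 itself, and then so is
     [m2]. *)
  assert (Su2 : smooth1 u2).
  { unfold u2, sp1, srcF; smooth.
    apply (smooth1_inv (fun x => 1 + eps ^ 2 + eps * 1 * sm z x * H2 (sp z x))); [smooth|].
    intros x; assert (T := sp1_den H H1 H2 DH1 Ht eps 1 z x (proj1 Heps) ltac:(lra) A); lra. }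
  assert (Sm2 : smooth1 m2) by (unfold m2, sr1; fold u2; smooth).
  assert (TU : C2T (su z) (sp z) u2).
  { split; [exact Pu|]; split; [intros x; apply is_derive_Reals, Du|].
    split; [intros x; apply is_derive_Reals, Dp | exact Cu2]. }
  assert (TM : C2T (sm z) (sr z) m2).
  { split; [exact Pm|]; split; [intros x; apply is_derive_Reals, Dm|].
    split; [intros x; apply is_derive_Reals, Dr | exact Cm2]. }
  exists (su z), (sp z), u2, (sm z), (sr z), m2.
  split; [|split; [split; [exact TU|]|split; [split; [exact TM|]|exact Hpos]]].
  - split; [exact TU|]; split; [exact TM|]; split; [exact Hpos|]; split.
    + intros x.
      assert (E : u2 x - eps * m2 x = su z x - eps * sm z x - srcF H V alpha eps 1 z x).
      (* Computing the derivative of u_x - eps m_x in two ways turns the integrated equation back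
         into the pointwise one. [Dflux1] is cleared, since [der] would otherwise apply it instead
         of differentiating term by term. *)
      { rewrite <- (is_derive_unique _ x _ (Dflux1 x)); symmetry; apply is_derive_unique.
        clear Dflux1; der; ring. }
      unfold srcF in E; lra.
    + exists (fun x => H2 (sp z x) * u2 x * sm z x + H1 (sp z x) * sr z x); split.
      * intros x; apply is_derive_Reals; der; ring.
      * intros x; unfold m2, sr1; fold (u2 x); ring.
  - apply smooth1_holder; [exact (periodic1_der (sp z) u2 Pp Dp) | exact Su2].
  - apply smooth1_holder; [exact (periodic1_der (sr z) m2 Pr Dr) | exact Sm2].
Qed.
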